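(* Let $\lambda\ge0$, $K\ge0$. When $0<h\le1/\lambda$ (any $h>0$ if $\lambda=0$), the quasi-compact difference scheme $${}_{L}\mathcal{B}U_i^{n+1}-K\tau\left(\frac1{h^\alpha}\sum_{k=0}^{i+1}w_k^{(\alpha,\lambda)}U_{i-k+1}^{n+1}-\frac{\alpha\lambda^{\alpha-1}}{2h}\left(e^{\lambda h}U_{i+1}^{n+1}-e^{-\lambda h}U_{i-1}^{n+1}\right)+\lambda^\alpha(\alpha-1)\,{}_{L}\mathcal{B}U_i^{n+1}\right)={}_{L}\mathcal{B}U_i^n+\tau\,{}_{L}\mathcal{B}f_i^{n+1},\quad 1\le i\le M-1,\ 0\le n\le N-1,$$ is stable for all $1<\alpha<2$.
   Context: The scheme discretizes $\partial_tu=K\,{}_aD_x^{\alpha,\lambda}u+f$ on $(a,b)\times(0,T]$ with $u(x,0)=u_0(x)$, $u(a,t)=0$, $u(b,t)=u_b(t)$, on the grid $x_i=a+ih$, $h=(b-a)/M$, $t_n=n\tau$, $\tau=T/N$ ($M,N$ positive integers), with $f_i^n=f(x_i,t_n)$ and boundary values $U_0^n=0$, $U_M^n=u_b(t_n)$. Here ${}_aD_x^{\alpha,\lambda}u(x)=\frac{e^{-\lambda x}}{\Gamma(2-\alpha)}\frac{d^2}{dx^2}\int_a^x(x-s)^{1-\alpha}e^{\lambda s}u(s)ds-\lambda^\alpha u(x)-\alpha\lambda^{\alpha-1}u'(x)$. The compact operator is ${}_{L}\mathcal{B}V_i=\frac16e^{-\lambda h}V_{i-1}+\frac23V_i+\frac16e^{\lambda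 h}V_{i+1}$. The weights: let $g_k^{(\alpha)}=\frac{\Gamma(k-\alpha)}{\Gamma(-\alpha)\Gamma(k+1)}$, $\mu_{-1}=\frac1{24}(4-7\alpha+3\alpha^2)$, $\mu_0=\frac1{12}(8+\alpha-3\alpha^2)$, $\mu_1=\frac1{24}(4+5\alpha+3\alpha^2)$. Then $w_0^{(\alpha,\lambda)}=\mu_1g_0^{(\alpha)}e^{\lambda h}$, $w_1^{(\alpha,\lambda)}=\mu_1g_1^{(\alpha)}+\mu_0g_0^{(\alpha)}$, and $w_k^{(\alpha,\lambda)}=(\mu_1g_k^{(\alpha)}+\mu_0g_{k-1}^{(\alpha)}+\mu_{-1}g_{k-2}^{(\alpha)})e^{(1-k)\lambda h}$ for $k\ge2$. Stability: the scheme is stable if there is a constant $C$, independent of $n,\tau,h$ (it may depend on $\alpha,\lambda,K,a,b,T$), such that for any two solutions $\tilde U,U$ of the scheme with the same $f$ and the same boundary values but possibly different initial values, the difference $\varepsilon^n=\tilde U^n-U^n$ (which vanishes at $i=0$ and $i=M$) satisfies $\|\varepsilon^n\|\le C\|\varepsilon^0\|$ for all $0\le n\le N$, where $\|v\|^2=h\sum_{i=1}^{M-1}v_i^2$. *)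

(* Defs.v *)
From HB Require Import structures.
From mathcomp Require Import all_boot all_order all_algebra.
From mathcomp Require Import all_classical all_reals all_analysis.

Set Implicit Arguments.
Unset Strict Implicit.
Unset Printing Implicit Defensive.

Import Order.TTheory GRing.Theory Num.Theory.
Import numFieldNormedType.Exports.

Local Open Scope classical_set_scope.
Local Open Scope ring_scope.

Section Gamma.
Context {R : realType}.

(* Euler's integral of the second kind, meaningful for 0 < x. *)
Definition Gamma_integral (x : R) : R :=
  \int[@lebesgue_measure R]_(t in `]0, +oo[) (t `^ (x - 1) * expR (- t)).

(* For x <= 0, m is the least natural number with 0 < x + m, and
   Gamma (x + m) = x * (x + 1) * ... * (x + m - 1) * Gamma x is solved for
   Gamma x; at the poles 0, -1, -2, ... the value is 0 since 0^-1 = 0. *)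
Definition Gamma (x : R) : R :=
  if 0 < x then Gamma_integral x
  else let m := (Num.truncn (- x)).+1 in
       Gamma_integral (x + m%:R) / \prod_(j < m) (x + j%:R).

End Gamma.

Section Scheme.
Context {R : realType}.
Implicit Types (alpha lambda K a b T h tau : R) (k i n M N : nat) (V : nat -> R).

Definition g_coef alpha k : R :=
  Gamma (k%:R - alpha) / (Gamma (- alpha) * Gamma (k%:R + 1)).

Definition mu_m1 alpha : R := (4 - 7 * alpha + 3 * alpha ^+ 2) / 24.
Definition mu_0 alpha : R := (8 + alpha - 3 * alpha ^+ 2) / 12.
Definition mu_1 alpha : R := (4 + 5 * alpha + 3 * alpha ^+ 2) / 24.

Definition weight alpha lambda h k : R :=
  match k with
  | 0%N => mu_1 alpha * g_coef alpha 0 * expR (lambda * h)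
  | 1%N => mu_1 alpha * g_coef alpha 1 + mu_0 alpha * g_coef alpha 0
  | (j.+2)%N =>
      (mu_1 alpha * g_coef alpha j.+2 + mu_0 alpha * g_coef alpha j.+1
        + mu_m1 alpha * g_coef alpha j) * expR ((1 - k%:R) * lambda * h)
  end.

(* Grid functions are indexed by nat; only the values at 0, ..., M matter, and
   the operators below are only used at interior indices 1 <= i <= M - 1. *)
Definition compact_op lambda h V i : R :=
  1 / 6 * expR (- (lambda * h)) * V i.-1 + 2 / 3 * V i
  + 1 / 6 * expR (lambda * h) * V i.+1.

(* The powers of lambda follow the convention 0 `^ r = 0 for r != 0. *)
Definition space_op alpha lambda h V i : R :=
  (h `^ alpha)^-1
    * (\sum_(0 <= k < i.+2) weight alpha lambda h k * V (i.+1 - k)%N)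
  - alpha * lambda `^ (alpha - 1) / (2 * h)
    * (expR (lambda * h) * V i.+1 - expR (- (lambda * h)) * V i.-1)
  + lambda `^ alpha * (alpha - 1) * compact_op lambda h V i.

Definition mesh a b M : R := (b - a) / M%:R.

Definition time_step T N : R := T / N%:R.

(* U n i is the numerical solution at time level n and grid point i. *)
Definition scheme_solution alpha lambda K a b T M N
    (f : R -> R -> R) (ub u0 : R -> R) (U : nat -> nat -> R) : Prop :=
  let h := mesh a b M in
  let tau := time_step T N in
  let x i := a + i%:R * h in
  let t n := n%:R * tau in
  [/\ forall i, (1 <= i <= M.-1)%N -> U 0%N i = u0 (x i),
      forall n, (n <= N)%N -> U n 0%N = 0,
      forall n, (n <= N)%N -> U n M = ub (t n) &
      forall i n, (1 <= i <= M.-1)%N -> (n <= N.-1)%N ->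
        compact_op lambda h (U n.+1) i
          - K * tau * space_op alpha lambda h (U n.+1) i
        = compact_op lambda h (U n) i
          + tau * compact_op lambda h (fun j => f (x j) (t n.+1)) i].

Definition grid_norm M h V : R := Num.sqrt (h * \sum_(1 <= i < M) V i ^+ 2).

(* admissible restricts the space steps h for which stability is claimed. *)
Definition scheme_stable alpha lambda K a b T (admissible : R -> Prop) : Prop :=
  exists C : R, forall M N, (0 < M)%N -> (0 < N)%N ->
    admissible (mesh a b M) ->
    forall (f : R -> R -> R) (ub u0 u0' : R -> R) (U U' : nat -> nat -> R),
      scheme_solution alpha lambda K a b T M N f ub u0 U ->
      scheme_solution alpha lambda K a b T M N f ub u0' U' ->
      forall n, (n <= N)%N ->
        grid_norm M (mesh a b M) (fun i => U' n i - U n i)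
        <= C * grid_norm M (mesh a b M) (fun i => U' 0%N i - U 0%N i).

End Scheme.

(* Main.v *)
Require Import Defs.
From mathcomp Require Import all_boot all_order all_algebra.
From mathcomp Require Import all_classical all_reals all_analysis.
From mathcomp Require Import measurable_realfun.
From mathcomp Require Import zify ring lra.

Import Order.TTheory GRing.Theory Num.Theory.
Import numFieldNormedType.Exports.
Local Open Scope ring_scope.

(** The quadratic form of the space operator is nonpositive: its only possibly
    negative off-diagonal coefficient is the one at distance two, which the
    coefficients at distance one compensate, and its coefficients add up to a
    nonpositive number because the generating function of the weights is
    (1 - x)^alpha times a quadratic polynomial. Hence one implicit step enlarges
    the error by at most a constant factor, whatever the step sizes. For small
    time steps, the same fact with lambda = 0 applies to exp (lambda x_i) e_i:
    the first-order term becomes antisymmetric and drops out, and the compact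
    operator becomes a symmetric positive form that grows by a factor
    1 + O(tau) per step. The other time steps are so large that boundedly many
    of them fit into [0, T]. *)

(** * Taylor bounds for the exponential on [0, 1] *)

Section ExpTaylor.
Context {R : realType}.
Implicit Types (x y s c : R) (n : nat).

(** Neither of the two growth estimates suffices alone. For lambda > 0 the compact operator is not
    symmetric, so testing with the error itself leaves a cross term that only Young's inequality
    controls; the resulting factor per step exceeds 1 by a fixed amount and cannot be iterated
    without a bound on N. Tilting restores symmetry, but the zero-order term lambda^alpha (alpha -
    1) B remains with the sign of growth and leaves a factor 1 - 2 c tau in front of the new energy,
    useful only while c tau is small.

    The delicate inequality is the sign of the coefficient sum. With H = lambda h it is at most
    H^alpha times a function vanishing at alpha = 1; once the factor alpha - 1 is split off, the
    terms of order H and H^2 cancel as well, so the sign rests on order H^3. This forces sharp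
    explicit Taylor bounds for the exponentials, all of them on H <= 1.

    Since [Gamma] is given by an integral, the recurrence of the Grunwald coefficients has to be
    derived from Gamma(x + 1) = x Gamma(x), continued to the negative arguments -alpha and 1 -
    alpha. *)

Lemma iterated_derivative_ge0 (f : nat -> R -> R) c :
  (forall x, 0 <= x <= c -> 0 <= f 0%N x) ->
  (forall n, f n.+1 0 = 0) ->
  (forall n x, is_derive x 1 (f n.+1) (f n x)) ->
  forall n x, 0 <= x <= c -> 0 <= f n x.
Proof.
move=> f0 fS0 df; elim=> [|n IHn] x /[dup] hx /andP[x0 xc]; first exact: f0.
have inE1 z : z \in `]0, c[ -> 0 <= z <= c.
  by rewrite in_itv/= => /andP[/ltW -> /ltW ->].
rewrite -(fS0 n); apply: (@ger0_derive1_ndecr _ (f n.+1) 0 c) => //.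
- by move=> z /inE1 hz; rewrite derive1E derive_val IHn.
- by apply: derivable_within_continuous => z _.
Qed.

Definition exp_taylor s n x := \sum_(i < n) (s * x) ^+ i / i`!%:R.

Lemma is_derive_monomial c n x :
  is_derive x 1 (fun y => c * y ^+ n.+1) (c * (n.+1%:R * x ^+ n)).
Proof.
have -> : (fun y => c * y ^+ n.+1) = c \*: (id ^+ n.+1 : R -> R).
  by apply/funext => y /=; rewrite fctE/=.
by apply: is_derive_eq; rewrite /GRing.scale/= mulr1.
Qed.

Lemma is_derive_exp_taylor s n x :
  is_derive x 1 (exp_taylor s n.+1) (s * exp_taylor s n x).
Proof.
elim: n => [|n IHn].
  rewrite /exp_taylor big_ord0 mulr0.
  have -> : (fun y => \sum_(i < 1) (s * y) ^+ i / i`!%:R) = cst (1 : R).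
    by apply/funext => y; rewrite big_ord_recr big_ord0/= add0r expr0 fact0 divr1.
  exact: is_derive_cst.
have -> : exp_taylor s n.+2 =
    exp_taylor s n.+1 \+ (fun y => (s ^+ n.+1 / n.+1`!%:R) * y ^+ n.+1).
  apply/funext => y; rewrite /exp_taylor big_ord_recr/=; congr (_ + _).
  by rewrite exprMn mulrAC.
rewrite [in X in is_derive _ _ _ X]/exp_taylor big_ord_recr/= mulrDr.
apply: is_deriveD; apply: (@is_derive_eq _ _ _ _ _ _ _ _ (is_derive_monomial _ _ _)).
rewrite factS natrM.
have fn0 : n`!%:R != 0 :> R by rewrite pnatr_eq0 -lt0n fact_gt0.
have n0 : n.+1%:R != 0 :> R by rewrite pnatr_eq0.
move: n.+1%:R n0 n`!%:R fn0 => p p0 q q0.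
by rewrite exprS exprMn; field; rewrite p0 q0.
Qed.

Lemma is_derive_expRM s x : is_derive x 1 (fun y => expR (s * y)) (s * expR (s * x)).
Proof.
by apply: is_derive_eq; rewrite /GRing.scale/= mulr1 mulrC.
Qed.

Lemma exp_taylor0 s n : exp_taylor s n.+1 0 = 1.
Proof.
rewrite /exp_taylor big_ord_recl expr0 fact0 divr1 big1 ?addr0// => i _.
by rewrite mulr0 expr0n/= mul0r.
Qed.

(** Differentiating exp (s x) - T_n (s x) lowers n by one and produces a factor s; the prefactor s^n
    absorbs it because s^2 = 1. Both exp x and exp (- x) are thus covered by one induction. *)
Lemma exp_taylor_remainder_sign s n x : s ^+ 2 = 1 -> 0 <= x ->
  0 <= s ^+ n * (expR (s * x) - exp_taylor s n x).
Proof.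
move=> s2 x0.
apply: (@iterated_derivative_ge0
  (fun n x => s ^+ n * (expR (s * x) - exp_taylor s n x)) x); last by rewrite x0 lexx.
- by move=> y _; rewrite expr0 mul1r /exp_taylor big_ord0 subr0 expR_ge0.
- by move=> m; rewrite exp_taylor0 mulr0 expR0 subrr mulr0.
move=> m y.
have dE := is_derive_expRM s y; have dT := is_derive_exp_taylor s m y.
apply: is_derive_eq.
by rewrite /GRing.scale/= -mulrBr mulrA -exprSr exprS exprS mulrA -expr2 s2 mul1r.
Qed.

Lemma expR_le_exp_taylor n x : 0 <= x <= 1 ->
  expR x <= exp_taylor 1 n x + expR 1 / n`!%:R * x ^+ n.
Proof.
move=> x01.
pose f n (x : R) := expR 1 / n`!%:R * x ^+ n - (expR (1 * x) - exp_taylor 1 n x).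
suff : 0 <= f n x by rewrite /f mul1r; lra.
apply: (@iterated_derivative_ge0 f 1) => //.
- move=> y /andP[_ y1]; rewrite /f /exp_taylor big_ord0 expr0 fact0 mulr1 divr1.
  by rewrite subr0 mul1r subr_ge0 ler_expR.
- move=> m; rewrite /f exp_taylor0 mulr0 expR0 subrr subr0 expr0n/=.
  by rewrite mulr0.
move=> m y.
have dE := is_derive_expRM 1 y; have dT := is_derive_exp_taylor 1 m y.
have dM := is_derive_monomial (expR 1 / m.+1`!%:R) m y.
rewrite /f; apply: is_derive_eq.
rewrite !mul1r; congr (_ - _); rewrite factS natrM.
have : m`!%:R != 0 :> R by rewrite pnatr_eq0 -lt0n fact_gt0.
have : m.+1%:R != 0 :> R by rewrite pnatr_eq0.
move: m.+1%:R m`!%:R => p q p0 q0.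
by field; rewrite p0 q0.
Qed.

Lemma expR1_le3 : expR 1 <= 3 :> R.
Proof.
have := @expR_le_exp_taylor 3 1; rewrite ler01 lexx => /(_ isT).
rewrite /exp_taylor !big_ord_recr big_ord0/= !mul1r !expr1n !factS fact0.
by rewrite !natrM; lra.
Qed.

Lemma expR_bounds x : 0 <= x <= 1 ->
  [/\ 1 + x + x ^+ 2 / 2 + x ^+ 3 / 6 + x ^+ 4 / 24 + x ^+ 5 / 120 <= expR x,
      expR x <= 1 + x + x ^+ 2 / 2 + x ^+ 3 / 6 + x ^+ 4 / 24 + x ^+ 5 / 120
                + x ^+ 6 / 240,
      1 - x + x ^+ 2 / 2 - x ^+ 3 / 6 + x ^+ 4 / 24 - x ^+ 5 / 120
        <= expR (- x) &
      expR (- x) <= 1 - x + x ^+ 2 / 2 - x ^+ 3 / 6 + x ^+ 4 / 24 - x ^+ 5 / 120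
                    + x ^+ 6 / 720].
Proof.
move=> x01; have x0 : 0 <= x by case/andP: x01.
have s1 : 1 ^+ 2 = 1 :> R by rewrite expr1n.
have sN1 : (-1) ^+ 2 = 1 :> R by rewrite sqrrN expr1n.
have x60 : 0 <= x ^+ 6 by apply: exprn_ge0.
(* With e <= 3 the remainder e x^6 / 720 becomes x^6 / 240. *)
have e3 : expR 1 / 720 * x ^+ 6 <= 3 / 720 * x ^+ 6.
  by apply: ler_wpM2r => //; have := expR1_le3; lra.
have A := @exp_taylor_remainder_sign 1 6 x s1 x0.
have B := @expR_le_exp_taylor 6 x x01.
have C := @exp_taylor_remainder_sign (-1) 6 x sN1 x0.
have D := @exp_taylor_remainder_sign (-1) 7 x sN1 x0.
move: A B C D; rewrite /exp_taylor !big_ord_recr !big_ord0/= !mulN1r !mul1r.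
rewrite !expr1n !factS fact0 !muln1.
rewrite (_ : (-1) ^+ 6 = 1); last by ring.
rewrite (_ : (-1) ^+ 7 = -1); last by ring.
rewrite -[(6 * _)%N]/720%N -[(5 * _)%N]/120%N -[(4 * _)%N]/24%N -[(3 * _)%N]/6%N.
move=> A B C D; split; lra.
Qed.

End ExpTaylor.

(** * Sign of the coefficient sum for lambda > 0 *)

Section SymbolSum.
Context {R : realType}.
Implicit Types (d h x y : R).

(** Weakening the Taylor coefficient 1/6 to 1/7 frees y^3 / 42, which pays for the quartic term
    while y <= 1/2. *)
Lemma le_expRN_cubic y : 0 <= y <= 1 / 2 ->
  expR (- y) <= 1 - y + y ^+ 2 / 2 - y ^+ 3 / 7.
Proof.
move=> y12; have [_ _ _] := @expR_bounds R y ltac:(lra).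
suff : 0 <= y ^+ 3 * (1 / 42 - y / 24 + y ^+ 2 / 120 - y ^+ 3 / 720) by lra.
by apply: mulr_ge0; [apply: exprn_ge0; lra|nra].
Qed.

(** With x = h / 2 the quotient is exp (- x) sinh(x) / x, and sinh(x) / x <= exp (x^2 / 6), where
    x^2 / 6 = h^2 / 24. *)
Lemma onem_expRN_le h : 0 < h <= 1 ->
  (1 - expR (- h)) / h <= expR (- (h / 2 - h ^+ 2 / 24)).
Proof.
move=> h01; set x := h / 2.
have hx : h = 2 * x by rewrite /x; lra.
have x0 : 0 < x <= 1 / 2 by rewrite /x; lra.
clearbody x.
have [_ A B _] := @expR_bounds R x ltac:(lra).
have C : 1 + x ^+ 2 / 6 + x ^+ 4 / 100 <= expR (x ^+ 2 / 6).
  have y01 : 0 <= x ^+ 2 / 6 <= 1.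
    have : 0 <= (1 - x) * x by apply: mulr_ge0; lra.
    by have := sqr_ge0 x; lra.
  have [+ _ _ _] := @expR_bounds R (x ^+ 2 / 6) y01.
  have y0 : 0 <= x ^+ 2 / 6 by lra.
  have := exprn_ge0 3 y0; have := exprn_ge0 4 y0; have := exprn_ge0 5 y0.
  have y2 : x ^+ 4 = 36 * (x ^+ 2 / 6) ^+ 2 by lra.
  by have := sqr_ge0 (x ^+ 2 / 6); rewrite y2; move: (x ^+ 2 / 6) => y *; lra.
rewrite ler_pdivrMr; last by lra.
rewrite (_ : - (x - h ^+ 2 / 24) = - x + x ^+ 2 / 6); last by rewrite hx; lra.
rewrite expRD.
have -> : 1 - expR (- h) = expR (- x) * (expR x - expR (- x)).
  rewrite mulrBr -!expRD addNr expR0; congr (_ - expR _); rewrite hx; lra.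
rewrite -mulrA; apply: ler_wpM2l; first exact: expR_ge0.
apply: (@le_trans _ _ ((1 + x ^+ 2 / 6 + x ^+ 4 / 100) * h)); last first.
  by apply: ler_wpM2r => //; lra.
rewrite hx; suff : 0 <= x ^+ 5 * (1 / 50 - 1 / 60 - x / 240) by lra.
by apply: mulr_ge0; [apply: exprn_ge0; lra|lra].
Qed.

(* Bounds (u^d - 1) / d for u = (1 - exp (- h)) / h, expanding u^d with
   ln u <= - (h / 2 - h^2 / 24). *)
Definition powR_slope d h : R :=
  - (h / 2 - h ^+ 2 / 24) + d * (h ^+ 2 / 8 - h ^+ 3 / 52) - d ^+ 2 * h ^+ 3 / 75.

Lemma onem_expRN_powR_le d h : 0 <= d <= 1 -> 0 < h <= 1 ->
  ((1 - expR (- h)) / h) `^ d <= 1 + d * powR_slope d h.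
Proof.
move=> d01 h01; set m := h / 2 - h ^+ 2 / 24.
have u0 : 0 <= (1 - expR (- h)) / h.
  by apply: divr_ge0; [rewrite subr_ge0 expR_le1; lra|lra].
have m0 : 0 <= m <= 1 / 2 by rewrite /m; nra.
have -> : 1 + d * powR_slope d h =
   1 - m * d + d ^+ 2 * (h ^+ 2 / 8 - h ^+ 3 / 52) - d ^+ 3 * h ^+ 3 / 75.
  by rewrite /powR_slope /m; lra.
apply: (@le_trans _ _ (expR (- (m * d)))).
  rewrite -mulNr expRM; apply: ge0_ler_powR; rewrite ?nnegrE ?expR_ge0//; first lra.
  exact: onem_expRN_le.
apply: (le_trans (@le_expRN_cubic (m * d) _)); first by nra.
(* These bounds on m^2 and m^3, divided by 2 and 7 as in [le_expRN_cubic], give the constants 52 and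
   75 of [powR_slope]. *)
have m2 : m ^+ 2 <= h ^+ 2 / 4 - h ^+ 3 / 26.
  suff : 0 <= h ^+ 3 * (1 / 24 - 1 / 26 - h / 576) by rewrite /m; lra.
  by apply: mulr_ge0; [apply: exprn_ge0; lra|lra].
have m3 : 7 * h ^+ 3 / 75 <= m ^+ 3.
  have -> : 7 * h ^+ 3 / 75 = h ^+ 3 * (7 / 75) by lra.
  have -> : m ^+ 3 = h ^+ 3 * (1 / 2 - h / 24) ^+ 3 by rewrite /m; lra.
  apply: ler_wpM2l; first by apply: exprn_ge0; lra.
  have : (11 / 24) ^+ 3 <= (1 / 2 - h / 24) ^+ 3.
    by rewrite ler_pXn2r ?nnegrE//; lra.
  lra.
have d2 : 0 <= d ^+ 2 by apply: exprn_ge0; lra.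
have d3 : 0 <= d ^+ 3 by apply: exprn_ge0; lra.
have := ler_wpM2l d2 m2; have := ler_wpM2l d3 m3.
rewrite !exprMn; lra.
Qed.

(* Bounds u nu, where p + d u nu is the factor multiplying u^d in
   scaled_symbol_sum_le0 and p = sinh h / h is its value at d = 0. *)
Definition slope_majorant d h : R :=
  h / 2 + (3 * d - 1) * h ^+ 2 / 24 + (1 / 16 - 7 / 240 * d) * h ^+ 3.

Lemma slope_majorant_ge d h : 0 <= d <= 1 -> 0 < h <= 1 ->
  (1 - h / 2 + h ^+ 2 / 6 - h ^+ 3 / 30) *
  ((h + h ^+ 3 / 6 + h ^+ 5 / 96) / 2 +
    (5 + 3 * d) / 12 * (h ^+ 2 / 2 + h ^+ 4 / 20)) <= slope_majorant d h.
Proof.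
move=> d01 h01.
(* The certificate: multiplied-out nonnegative products of [h], [1 - h], [d], [1 - d], after which
   the claim is linear in the monomials. *)
have mono k : 0 <= h ^+ k * (1 - h) by apply: mulr_ge0; [apply: exprn_ge0|]; lra.
have dmono k : 0 <= d * (h ^+ k * (1 - h)) by apply: mulr_ge0; [lra|exact: mono].
have cmono k : 0 <= (1 - d) * (h ^+ k * (1 - h)).
  by apply: mulr_ge0; [lra|exact: mono].
have h80 : 0 <= h ^+ 8 by apply: exprn_ge0; lra.
have dh80 : 0 <= d * h ^+ 8 by apply: mulr_ge0 => //; lra.
have := mono 3%N; have := mono 4%N; have := mono 5%N; have := mono 6%N.
have := mono 7%N.
have := dmono 3%N; have := dmono 4%N; have := dmono 5%N; have := dmono 6%N.
have := dmono 7%N; have := cmono 3%N; have := cmono 4%N; have := cmono 5%N.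
rewrite /slope_majorant; lra.
Qed.

(** The coefficients of h and h^2 cancel identically in d, the latter as d/8 + d/8 - d/4. The
    coefficient of h^3 is at most -1/48, and this margin carries everything of higher order,
    including h^4 / 138. *)
Lemma slope_sum_le0 d h : 0 <= d <= 1 -> 0 < h <= 1 ->
  slope_majorant d h * (1 + d * powR_slope d h)
  + powR_slope d h * (1 + h ^+ 2 / 6) + h ^+ 4 / 138 <= 0.
Proof.
move=> d01 h01.
have mono i k : 0 <= d ^+ i * (h ^+ k * (1 - h)).
  by repeat apply: mulr_ge0; try apply: exprn_ge0; lra.
have dmono i k : 0 <= d ^+ i * (1 - d) * h ^+ k.
  by repeat apply: mulr_ge0; try apply: exprn_ge0; lra.
have pos i k : 0 <= d ^+ i * h ^+ k by apply: mulr_ge0; apply: exprn_ge0; lra.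
have := mono 0%N 3%N; have := mono 1%N 3%N; have := mono 2%N 3%N.
have := mono 2%N 4%N; have := mono 2%N 5%N; have := mono 3%N 3%N.
have := mono 3%N 4%N; have := mono 3%N 5%N; have := mono 4%N 5%N.
have := dmono 0%N 3%N; have := dmono 1%N 3%N; have := dmono 2%N 3%N.
have := pos 1%N 4%N; have := pos 1%N 5%N; have := pos 4%N 5%N; have := pos 4%N 6%N.
have := pos 2%N 3%N; have := pos 3%N 3%N; have := pos 3%N 5%N; have := pos 3%N 6%N.
have := pos 2%N 6%N; have := pos 1%N 3%N; have := pos 0%N 3%N; have := pos 3%N 4%N.
rewrite /slope_majorant /powR_slope !expr0 !expr1 !mul1r; lra.
Qed.

Lemma powR_slope_le0 d h : 0 <= d <= 1 -> 0 < h <= 1 -> powR_slope d h <= 0.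
Proof.
move=> d01 h01.
have dh : 0 <= (1 - d) * h ^+ 2 by apply: mulr_ge0; [|apply: exprn_ge0]; lra.
have d3 : 0 <= d * h ^+ 3 by apply: mulr_ge0; [|apply: exprn_ge0]; lra.
have d23 : 0 <= d ^+ 2 * h ^+ 3 by apply: mulr_ge0; apply: exprn_ge0; lra.
have h2 : 0 <= h * (1 - h) by apply: mulr_ge0; lra.
by rewrite /powR_slope; lra.
Qed.

(* The sum of all coefficients of the space operator, divided by H^alpha, for
   alpha = 1 + d and H = h. It vanishes at d = 0 and is O(h^3), so it is its
   slope in d that has to be bounded, to third order in h. *)
Lemma scaled_symbol_sum_le0 d h : 0 <= d <= 1 -> 0 < h <= 1 ->
  let x := expR h in let y := expR (- h) in
  ((1 - y) / h) `^ d * ((1 - y) / h * ((12 + 11 * d + 3 * d ^+ 2) / 24 * x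
    + (6 - 5 * d - 3 * d ^+ 2) / 12 + (3 * d ^+ 2 - d) / 24 * y))
  - (1 + d) * ((x - y) / (2 * h)) + d * (2 / 3 + (x + y) / 6) <= 0.
Proof.
move=> d01 h01 /=; set x := expR h; set y := expR (- h); set u := (1 - y) / h; set w := u `^ d.
have [xl xu yl yu] := @expR_bounds R h ltac:(lra).
rewrite -/x -/y in xl xu yl yu.

have xy : x * y = 1 by rewrite /x /y -expRD subrr expR0.
have x1 : 1 <= x by rewrite /x -expR0 ler_expR; lra.
have y01 : 0 <= y <= 1 by rewrite /y expR_ge0 expR_le1; lra.
have w0 : 0 <= w by exact: powR_ge0.
have wle : w <= 1 + d * powR_slope d h by exact: onem_expRN_powR_le.
have uh : u * h = 1 - y by rewrite /u divfK//; lra.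
have u0 : 0 <= u by apply: divr_ge0; lra.
set p := (x - y) / (2 * h).
have ph : 2 * p * h = x - y by rewrite /p; field; lra.
pose b := u * ((11 + 3 * d) / 24 * x - (10 + 6 * d) / 24 + (3 * d - 1) / 24 * y).
have h_gt0 : 0 < h by lra.
clearbody w p u x y.
have ux : u * (x + 1) / 2 = p.
  apply: (@mulIf _ h); first by lra.
  have : u * h * (x + 1) = (1 - y) * (x + 1) by rewrite uh.
  by clear -xy ph; lra.
have -> : u * ((12 + 11 * d + 3 * d ^+ 2) / 24 * x
    + (6 - 5 * d - 3 * d ^+ 2) / 12 + (3 * d ^+ 2 - d) / 24 * y) = p + d * b.
  by rewrite -ux /b; clear; lra.
have mono k : 0 <= h ^+ k * (1 - h).
  by clear -h01; apply: mulr_ge0; [apply: exprn_ge0|]; lra.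
have h2 := mono 1%N; have h3 := mono 2%N; have h4 := mono 3%N; have h5 := mono 4%N.
have h6 := mono 5%N; have h7 := mono 6%N; have h70 : 0 <= h ^+ 7 by apply/exprn_ge0/ltW.
have u_le : u <= 1 - h / 2 + h ^+ 2 / 6 - h ^+ 3 / 30.
  by rewrite -(ler_pM2r h_gt0) uh; clear -yl h5; lra.
have p_ge : 1 + h ^+ 2 / 6 + h ^+ 4 / 120 - h ^+ 5 / 1440 <= p.
  by rewrite -(ler_pM2r h_gt0); clear -ph xl yu h6; lra.
pose nu := (x - y) / 4 + (5 + 3 * d) / 12 * ((x + y) / 2 - 1).
have bE : b = u * nu by rewrite /b /nu; clear; lra.
have c_le : (x + y) / 2 - 1 <= h ^+ 2 / 2 + h ^+ 4 / 20.
  by clear -xu yu h5 h6 h7 h70; lra.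
have c_ge : 0 <= (x + y) / 2 - 1 
  by have := sqr_ge0 h; have := sqr_ge0 (h ^+ 2); clear -xl yl; lra.
have nu0 : 0 <= nu.
  by apply: addr_ge0; [clear -x1 y01; lra|apply: mulr_ge0 => //; clear -d01; lra].
have nu_le : nu <= (h + h ^+ 3 / 6 + h ^+ 5 / 96) / 2 +
    (5 + 3 * d) / 12 * (h ^+ 2 / 2 + h ^+ 4 / 20).
  apply: lerD; first by clear -xu yl h6 h7 h70; lra.
  by apply: ler_wpM2l => //; clear -d01; lra.
have b_le : b <= slope_majorant d h.
  rewrite bE; apply: le_trans (@slope_majorant_ge d h d01 h01).
  exact: ler_pM.
have b0 : 0 <= b by rewrite bE mulr_ge0.
have slope0 := @powR_slope_le0 d h d01 h01.
(* 2/3 + cosh(h)/3 and sinh(h)/h agree through order h^3; their difference starts with h^4/72 -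
   h^4/120 = h^4/180, and 138 leaves room for the remainders. *)
have rp : 2 / 3 + (x + y) / 6 - p <= h ^+ 4 / 138.
  by clear -p_ge xu yu h5 h6 h7 h70; lra.
have slope := @slope_sum_le0 d h d01 h01.
have p_ge1 : 1 + h ^+ 2 / 6 <= p by have := sqr_ge0 (h ^+ 2); clear -p_ge h5; lra.
have := ler_wnM2l slope0 p_ge1.
have := ler_wpM2r (le_trans w0 wle) b_le.
set A := powR_slope d h in slope wle slope0 *.
have wuN : w * (p + d * b) <= (1 + d * A) * (p + d * b).
  apply: ler_wpM2r => //; apply: addr_ge0.
    by have := sqr_ge0 h; clear -p_ge1; lra.
  by apply: mulr_ge0 => //; case/andP: d01.
move=> F1 F2.
(* Once w is replaced by 1 + d A, the terms free of d cancel and the whole expression is d times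
   this bracket. *)
have : d * (b * (1 + d * A) + A * p + (2 / 3 + (x + y) / 6 - p)) <= 0.
  apply: mulr_ge0_le0; first by case/andP: d01.
  by clear -F1 F2 rp slope; lra.
by clear -wuN; lra.
Qed.

End SymbolSum.

(** * Quadratic forms of one-sided convolutions *)

Section ConvolutionForm.
Context {R : realType}.
Implicit Types (F W V a : nat -> R) (k i j n L M : nat).

(** Truncated subtraction sends every i <= j to index 0, where F vanishes, so it acts as a genuine
    shift with zero extension. *)
Lemma sum_shift F L j : F 0%N = 0 -> (forall i, (L <= i + j)%N -> F i = 0) ->
  \sum_(i < L) F (i - j)%N = \sum_(i < L) F i.
Proof.
move=> F0 FL; rewrite -[LHS](big_mkord xpredT (fun i => F (i - j)%N)) -[RHS](big_mkord xpredT F).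
have [Lj|jL] := leqP L j.
  rewrite !big_nat [LHS]big1 ?[RHS]big1// => i /andP[_ iL]; first by apply: FL; lia.
  by rewrite (_ : (i - j)%N = 0%N)//; lia.
rewrite (big_cat_nat _ (ltnW jL))//= big_nat big1 ?add0r; last first.
  by move=> i /andP[_ ij]; rewrite (_ : (i - j)%N = 0%N)//; lia.
rewrite -{1}(add0n j) big_addn.
rewrite [RHS](big_cat_nat _ (leq_subr j L))//=.
rewrite [X in _ + X]big_nat [X in _ + X]big1 ?addr0; last first.
  by move=> i /andP[ij _]; apply: FL; lia.
by apply: eq_bigr => i _; rewrite addnK.
Qed.

Lemma sum_shift_le F L j : F 0%N = 0 -> (forall i, 0 <= F i) ->
  \sum_(i < L) F (i - j)%N <= \sum_(i < L) F i.
Proof.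
move=> F0 Fge0; pose G i := if (i + j < L)%N then F i else 0.
have -> : \sum_(i < L) F (i - j)%N = \sum_(i < L) G (i - j)%N.
  apply: eq_bigr => i _; rewrite /G; have [ij|ji] := leqP i j.
    rewrite (_ : (i - j)%N = 0%N) ?F0 ?if_same//; lia.
  by rewrite subnK ?ltn_ord// ltnW.
rewrite sum_shift; first last.
- by move=> i Lij; rewrite /G ltnNge Lij.
- by rewrite /G F0 if_same.
by apply: ler_sum => i _; rewrite /G; case: ifP.
Qed.

Lemma autocorrelation_le W L j (rho := \sum_(i < L) W i ^+ 2) : W 0%N = 0 ->
  `|\sum_(i < L) W i * W (i - j)%N| <= rho.
Proof.
move=> W0.
have S : \sum_(i < L) W (i - j)%N ^+ 2 <= rho.
  apply: (@sum_shift_le (fun i => W i ^+ 2)); first by rewrite W0 expr0n.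
  by move=> i; exact: sqr_ge0.
have P : 0 <= \sum_(i < L) (W i + W (i - j)%N) ^+ 2.
  by apply: sumr_ge0 => i _; exact: sqr_ge0.
have N : 0 <= \sum_(i < L) (W i - W (i - j)%N) ^+ 2.
  by apply: sumr_ge0 => i _; exact: sqr_ge0.
rewrite ler_norml; apply/andP; split.
  move: P; under eq_bigr do rewrite sqrrD.
  by rewrite !big_split/= -/rho ?sumrMnl; lra.
move: N; under eq_bigr do rewrite sqrrB.
by rewrite !big_split/= sumrN -/rho ?sumrMnl; lra.
Qed.

(* W i - W (i - 2) is a sum of two consecutive first differences. *)
Lemma autocorrelation2_ge W L (rho := \sum_(i < L) W i ^+ 2) : W 0%N = 0 ->
  (forall i, (L <= i.+2)%N -> W i = 0) ->
  rho - \sum_(i < L) W i * W (i - 2)%N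
    <= 4 * (rho - \sum_(i < L) W i * W (i - 1)%N).
Proof.
move=> W0 WL.
have sumB j : (j <= 2)%N -> \sum_(i < L) (W i - W (i - j)%N) ^+ 2 =
    2 * (rho - \sum_(i < L) W i * W (i - j)%N).
  move=> j2; under eq_bigr do rewrite sqrrB.
  rewrite !big_split/= sumrN ?sumrMnl (@sum_shift (fun i => W i ^+ 2)); first 1 last.
  - by rewrite W0 expr0n.
  - by move=> i Lij; rewrite WL ?expr0n//; lia.
  by rewrite -/rho; lra.
pose D i := (W i - W (i - 1)%N) ^+ 2.
have DS : \sum_(i < L) D (i - 1)%N <= \sum_(i < L) D i.
  by apply: sum_shift_le => [|i]; rewrite /D ?subrr ?expr0n// sqr_ge0.
have : \sum_(i < L) (W i - W (i - 2)%N) ^+ 2 <=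
    \sum_(i < L) (2 * D i + 2 * D (i - 1)%N).
  apply: ler_sum => i _; rewrite /D -subnDA.
  by have := sqr_ge0 (W i - 2 * W (i - 1)%N + W (i - (1 + 1))%N); lra.
rewrite big_split/= -!mulr_sumr sumB// => S2.
by have := sumB 1%N isT; rewrite -/D; rewrite /D in DS *; lra.
Qed.

Lemma convolution_form W a L n : W 0%N = 0 -> (L < n)%N ->
  \sum_(i < L) W i * (\sum_(0 <= k < i.+2) a k * W (i.+1 - k)%N)
  = \sum_(k < n) a k * \sum_(i < L) W i * W (i.+1 - k)%N.
Proof.
move=> W0 Ln.
under [RHS]eq_bigr do rewrite mulr_sumr.
rewrite exchange_big/=; apply: eq_bigr => i _; rewrite mulr_sumr.
rewrite -(big_mkord xpredT (fun k => a k * (W i * W (i.+1 - k)%N))).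
have iL := ltn_ord i.
rewrite [RHS](@big_cat_nat _ _ _ i.+2)//=; last by lia.
rewrite [X in _ = _ + X]big_nat [X in _ = _ + X]big1 ?addr0; last first.
  move=> k /andP[ik _]; rewrite (_ : (i.+1 - k)%N = 0%N) ?W0 ?mulr0//; lia.
by apply: eq_bigr => k _; rewrite mulrCA.
Qed.

(* In terms of the autocorrelations r_j of W, the form is
   a_1 r_0 + (a_0 + a_2) r_1 + a_3 r_2 + sum_(k >= 4) a_k r_(k-1). Only a_3 may
   be negative, and then r_0 - r_2 <= 4 (r_0 - r_1) absorbs its term. *)
Lemma convolution_form_le0 W a L : W 0%N = 0 ->
  (forall i, (L <= i.+2)%N -> W i = 0) ->
  (forall k, (4 <= k)%N -> 0 <= a k) ->
  0 <= a 0%N + a 2%N -> 0 <= a 0%N + a 2%N + 4 * a 3%N ->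
  (forall n, (4 <= n)%N -> \sum_(k < n) a k <= 0) ->
  \sum_(i < L) W i * (\sum_(0 <= k < i.+2) a k * W (i.+1 - k)%N) <= 0.
Proof.
move=> W0 WL a4 a02 a023 suma.
rewrite (@convolution_form _ _ _ (4 + L)%N)//; last by lia.
set rho := fun k => \sum_(i < L) W i * W (i.+1 - k)%N.
pose r := \sum_(i < L) W i ^+ 2.
have r0 : 0 <= r by apply: sumr_ge0 => i _; exact: sqr_ge0.
have rhoS k : rho k.+1 = \sum_(i < L) W i * W (i - k)%N.
  by apply: eq_bigr => i _; rewrite subSS.
have rho1 : rho 1%N = r by rewrite rhoS; apply: eq_bigr => i _; rewrite subn0.
(* [rho 0] pairs W with its forward neighbour and [rho 2] with its backward one; they agree because
   W vanishes at both ends. *)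
have rho02 : rho 0%N = rho 2%N.
  pose F i := W i.+1 * W i.
  have -> : rho 0%N = \sum_(i < L) F i.
    by apply: eq_bigr => i _; rewrite subn0 mulrC.
  rewrite rhoS -(@sum_shift F L 1); first last.
  - by move=> i Li; rewrite /F (WL i) ?mulr0//; lia.
  - by rewrite /F W0 mulr0.
  apply: eq_bigr => i _; rewrite /F; have [->|i0] := posnP i.
    by rewrite W0 mulr0 mul0r.
  by rewrite subn1 prednK.
have rho_le k : (0 < k)%N -> rho k <= r.
  case: k => // k _; rewrite rhoS.
  exact: le_trans (ler_norm _) (@autocorrelation_le W L k W0).
have rho3 : r - rho 3%N <= 4 * (r - rho 2%N).
  by rewrite !rhoS; exact: autocorrelation2_ge.
have tail : \sum_(4 <= k < 4 + L) a k * rho k <= (\sum_(4 <= k < 4 + L) a k) * r.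
  rewrite mulr_suml !big_nat; apply: ler_sum => k /andP[k4 _].
  by apply: ler_wpM2l; [exact: a4|apply: rho_le; lia].
have split4 (b : nat -> R) : \sum_(k < 4 + L) b k =
    b 0%N + b 1%N + b 2%N + b 3%N + \sum_(4 <= k < 4 + L) b k.
  rewrite -(big_mkord xpredT) (@big_cat_nat _ _ _ 4)//=.
  by rewrite big_mkord !big_ord_recr big_ord0/= add0r.
have := suma (4 + L)%N isT; rewrite (split4 a) => sum0.
rewrite (split4 (fun k => a k * rho k)) rho1 rho02.
apply: (@le_trans _ _ ((a 0%N + a 1%N + a 2%N + a 3%N + \sum_(4 <= k < 4 + L) a k) * r));
  last by apply: mulr_le0_ge0.
have r2 := rho_le 2%N isT; have r3 := rho_le 3%N isT.
have [a3|a3] := leP 0 (a 3%N).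
  have := mulr_ge0 a3 (ltac:(lra) : 0 <= r - rho 3%N).
  have := mulr_ge0 a02 (ltac:(lra) : 0 <= r - rho 2%N).
  lra.
have := ler_wpM2l (ltac:(lra) : 0 <= - a 3%N) rho3.
have := mulr_ge0 a023 (ltac:(lra) : 0 <= r - rho 2%N).
lra.
Qed.

End ConvolutionForm.

(** * Euler's integral: functional equation, finiteness, positivity *)

Section GammaRecurrence.
Context {R : realType}.
Implicit Types (x y t : R) (n : nat).
Local Notation mu := (@lebesgue_measure R).
Local Open Scope classical_set_scope.

Definition euler_integrand x t : R := t `^ (x - 1) * expR (- t).

(** Kept extended-valued, so that the functional equation can be proved before integrability is
    known. *)
Definition euler_integral x : \bar R :=
  (\int[mu]_(t in `]0%R, +oo[) (euler_integrand x t)%:E)%E.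

Lemma euler_integrand_ge0 x t : 0 <= euler_integrand x t.
Proof. by rewrite mulr_ge0 ?powR_ge0 ?expR_ge0. Qed.

Lemma continuous_expRN : continuous (fun t : R => expR (- t)).
Proof. by move=> t; apply: continuous_comp; [exact: opp_continuous|exact: continuous_expR]. Qed.

Lemma continuous_powR x t : 0 < t -> {for t, continuous (fun s : R => s `^ x)}.
Proof.
move=> t0; apply/differentiable_continuous/derivable1_diffP.
by apply: derivable_powR; rewrite in_itv/= t0.
Qed.

Lemma continuous_euler_integrand x t : 0 < t ->
  {for t, continuous (euler_integrand x)}.
Proof.
by move=> t0; apply: continuousM; [exact: continuous_powR|exact: continuous_expRN].
Qed.

Lemma measurable_euler_integrand x :
  measurable_fun (`]0, +oo[ : set R) (EFin \o euler_integrand x).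
Proof.
apply/measurable_EFinP; apply: open_continuous_measurable_fun => //.
by move=> t; rewrite inE/= in_itv/= andbT => t0; exact: continuous_euler_integrand.
Qed.

(** The intervals [1/(n+2), n+2] exhaust the half-line; the offset 2 makes them nondegenerate
    already at n = 0, as integration by parts requires. *)
Let lo n : R := n.+2%:R^-1.
Let hi n : R := n.+2%:R.

Let lo_gt0 n : 0 < lo n. Proof. by rewrite invr_gt0 ltr0n. Qed.

Let lo_lt_hi n : lo n < hi n.
Proof.
apply: (@lt_trans _ _ 1); last by rewrite /hi ltr1n.
by rewrite invf_lt1 ?ltr0n// ltr1n.
Qed.

Let sub_itv n : `[lo n, hi n] `<=` (`]0, +oo[ : set R).
Proof.
move=> t /=; rewrite !in_itv/= andbT => /andP[+ _]; exact: lt_le_trans.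
Qed.

Lemma euler_integral_cvg x :
  (\int[mu]_(t in `[lo n, hi n]) (euler_integrand x t)%:E)%E @[n --> \oo]
    --> euler_integral x.
Proof.
have -> : euler_integral x =
    (\int[mu]_(t in \bigcup_n `[lo n, hi n]) (euler_integrand x t)%:E)%E.
  congr (integral _ _ _); apply/seteqP; split => [t /=|t [n _]]; last exact: sub_itv.
  rewrite in_itv/= andbT => t0.
  pose m := maxn (Num.bound t) (Num.bound t^-1).
  exists m => //=; rewrite in_itv/=; apply/andP; split.
    rewrite /lo invf_ple ?posrE ?ltr0n//.
    apply: (le_trans (ltW (archi_boundP _))); first by rewrite invr_ge0 ltW.
    by rewrite ler_nat (leq_trans (leq_maxr (Num.bound t) _))// !leqW.
  apply: (le_trans (ltW (archi_boundP _))); first exact: ltW.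
  by rewrite /hi ler_nat (leq_trans (leq_maxl _ (Num.bound t^-1)))// !leqW.
apply: ge0_nondecreasing_set_cvg_integral => //.
- apply/nondecreasing_seqP => n; rewrite subsetEset; apply: subset_itv.
    by rewrite bnd_simp /lo lef_pV2 ?posrE ?ltr0n// ler_nat.
  by rewrite bnd_simp /hi ler_nat.
- by move=> n; apply: measurable_funS (measurable_euler_integrand x) => //; exact: sub_itv.
- by move=> n t _; rewrite lee_fin euler_integrand_ge0.
Qed.

Lemma euler_integral_by_parts x n : 0 < x ->
  (\int[mu]_(t in `[lo n, hi n]) (euler_integrand (x + 1) t)%:E =
   (lo n `^ x * expR (- lo n) - hi n `^ x * expR (- hi n))%:E +
   x%:E * \int[mu]_(t in `[lo n, hi n]) (euler_integrand x t)%:E)%E.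
Proof.
move=> x0.
have pos t : t \in `[lo n, hi n]%R -> 0 < t.
  by rewrite in_itv/= => /andP[+ _]; exact: lt_le_trans.
have poso t : t \in `]lo n, hi n[%R -> 0 < t.
  by move=> h; apply: pos; exact: subset_itv_oo_cc h.
have cont (f : R -> R) : (forall t, 0 < t -> {for t, continuous f}) ->
    {within `[lo n, hi n], continuous f}.
  move=> cf; apply: continuous_in_subspaceT => t.
  by rewrite inE/= => /pos /cf.
have dLR (F : R -> R) : (forall t, 0 < t -> derivable F t 1) ->
    derivable_oo_LRcontinuous F (lo n) (hi n).
  move=> dF; have cF t : 0 < t -> {for t, continuous F}.
    by move=> t0; apply/differentiable_continuous/derivable1_diffP/dF.
  split.
  - by move=> t /poso /dF.
  - by apply: cvg_at_right_filter; apply: cF; exact: lo_gt0.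
  - apply: cvg_at_left_filter; apply: cF; exact: lt_trans (lo_gt0 n) (lo_lt_hi n).
have dE t : is_derive t 1 (fun s : R => - expR (- s)) (expR (- t)).
  by apply: is_derive_eq; rewrite /GRing.scale/=; lra.
transitivity (\int[mu]_(t in `[lo n, hi n]) (t `^ x * expR (- t))%:E)%E.
  by apply: eq_integral => t _; rewrite /euler_integrand addrK.
rewrite (@integration_by_parts R (fun t => t `^ x) (fun t => - expR (- t))
  (fun t => x * t `^ (x - 1)) (fun t => expR (- t)) _ _ (lo_lt_hi n)); first last.
- by move=> t _; rewrite derive1E derive_val.
- by apply: dLR => t _; exact: ex_derive.
- by apply: cont => t _; exact: continuous_expRN.
- by move=> t /poso t0; rewrite powR_derive1// in_itv/= t0.
- by apply: dLR => t t0; apply: derivable_powR; rewrite in_itv/= t0.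
- apply: cont => t t0; apply: continuousM; first exact: cst_continuous.
  exact: continuous_powR.
congr (_ + _)%E; first by congr (_%:E); lra.
rewrite -integralN/=; last first.
  rewrite fin_num_adde_defr// integral0_eq// => t tlohi.
  have neg s : `[lo n, hi n] s -> ((x * s `^ (x - 1) * - expR (- s))%:E <= 0)%E.
    move=> _; rewrite lee_fin mulrN oppr_le0.
    by rewrite !mulr_ge0 ?powR_ge0 ?expR_ge0// ltW.
  by rewrite (le0_funeposE neg)// inE.
rewrite -ge0_integralZl//=; last 3 first.
- apply: measurable_funS (measurable_euler_integrand x) => //; exact: sub_itv.
- by move=> t _; rewrite lee_fin euler_integrand_ge0.
- by rewrite lee_fin ltW.
by apply: eq_integral => t _; rewrite /euler_integrand; congr (_%:E); lra.
Qed.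

Lemma powR_expRN_cvg0 x : 0 <= x -> hi n `^ x * expR (- hi n) @[n --> \oo] --> (0 : R).
Proof.
move=> x0; set m := Num.bound x.
have xm : x <= m%:R by exact: ltW (archi_boundP x0).
apply: (@squeeze_cvgr _ _ _ _ (cst 0) (fun n => m.+1`!%:R * (n.+2%:R)^-1)).
- near=> n; apply/andP; split; first by rewrite mulr_ge0 ?powR_ge0 ?expR_ge0.
  have h1 : 1 <= hi n by rewrite /hi ler1n.
  have h0 : 0 < hi n by exact: lt_le_trans h1.
  apply: (@le_trans _ _ (hi n ^+ m * expR (- hi n))).
    by apply: ler_wpM2r; rewrite ?expR_ge0// -powR_mulrn ?(ltW h0)// ler_powR.
  (* From exp t >= 1 + t^(m+1) / (m+1)! one gets t^m exp (- t) <= (m+1)! / t. *)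
  rewrite expRN ler_pdivrMr ?expR_gt0// mulrAC ler_pdivlMr// -exprSr.
  have := @expR_ge1Dxn _ (hi n) m (ltW h0).
  have f0 : 0 < m.+1`!%:R :> R by rewrite ltr0n fact_gt0.
  move=> e1; rewrite mulrC -ler_pdivrMr//; lra.
- exact: cvg_cst.
- rewrite -(mulr0 (m.+1`!%:R : R)); apply: cvgMr.
  by have := @cvg_harmonic R; rewrite -(@cvg_shiftS R).
Unshelve. all: by end_near. Qed.

Lemma powR_lo_cvg0 x : 0 < x -> lo n `^ x * expR (- lo n) @[n --> \oo] --> (0 : R).
Proof.
move=> x0.
have lo0 : lo n @[n --> \oo] --> (0 : R).
  by have := @cvg_harmonic R; rewrite -(@cvg_shiftS R).
rewrite -(mul0r (expR (- 0))); apply: cvgM.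
  have /cvg_at_rightP := powR_cvg0 x0; exact.
exact: (cvg_comp lo (fun t : R => expR (- t)) lo0 (@continuous_expRN 0)).
Qed.

Lemma euler_integralS x : 0 < x -> euler_integral (x + 1) = (x%:E * euler_integral x)%E.
Proof.
move=> x0; rewrite -(cvg_lim (@ereal_hausdorff R) (@euler_integral_cvg (x + 1))).
under [X in lim (X @ _)]eq_fun do rewrite euler_integral_by_parts//.
apply/cvg_lim => //.
rewrite -[X in _ --> X]add0e; apply: cvgeD => //.
- apply: cvg_EFin; first exact: nearW.
  rewrite -(subr0 (0 : R)); apply: cvgB; first exact: powR_lo_cvg0.
  by apply: powR_expRN_cvg0; exact: ltW.
- by apply: cvgeZl => //; exact: euler_integral_cvg.
Qed.

Lemma euler_integral1 : euler_integral 1 = 1%E.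
Proof.
rewrite -(@integral_exponential_pdf R 1 ltr01) /euler_integral.
rewrite integral_itv_obnd_cbnd; last exact: measurable_euler_integrand.
rewrite integral_mkcond; apply: eq_integral => t _.
rewrite /exponential_pdf !patchE; case: ifP => // _.
by rewrite /euler_integrand subrr powRr0 !mul1r mulN1r.
Qed.

Lemma euler_integral_ge0 x : (0 <= euler_integral x)%E.
Proof. by apply: integral_ge0 => t _; rewrite lee_fin euler_integrand_ge0. Qed.

Lemma powR_le_add (a b c t : R) : a <= c <= b -> 0 < t -> t `^ c <= t `^ a + t `^ b.
Proof.
move=> /andP[ac cb] t0; have [t1|t1] := leP 1 t.
  by apply: ler_wpDl; [exact: powR_ge0|exact: ler_powR].
by apply: ler_wpDr; [exact: powR_ge0|apply: ger_powR; rewrite // t0 ltW].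
Qed.

Lemma euler_integral_le_add (a b c : R) : a <= c <= b ->
  (euler_integral c <= euler_integral a + euler_integral b)%E.
Proof.
move=> acb; have m := measurable_euler_integrand.
rewrite /euler_integral -ge0_integralD//=; last 4 first.
- by move=> t _; rewrite lee_fin euler_integrand_ge0.
- exact: m.
- by move=> t _; rewrite lee_fin euler_integrand_ge0.
- exact: m.
apply: ge0_le_integral => //=.
- by move=> t _; rewrite lee_fin euler_integrand_ge0.
- exact: m.
- by apply: emeasurable_funD; exact: m.
move=> t; rewrite in_itv/= andbT => t0; rewrite -EFinD lee_fin -mulrDl.
by apply: ler_wpM2r; [exact: expR_ge0|apply: powR_le_add => //; lra].
Qed.

(** Since t^x <= 1 + t, the integral at x + 1 is at most the sum of those at 1 and 2. It equals x
    times the integral at x, so finiteness descends to x without an estimate near t = 0. *)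
Lemma euler_integral_fin_num x : 0 < x <= 1 -> euler_integral x \is a fin_num.
Proof.
move=> /andP[x0 x1]; rewrite ge0_fin_numE; last exact: euler_integral_ge0.
have : (euler_integral (x + 1) < +oo)%E.
  have := @euler_integral_le_add 1 (1 + 1) (x + 1) ltac:(lra).
  by rewrite (@euler_integralS 1)// euler_integral1 mul1e => /le_lt_trans; apply; rewrite ltry.
rewrite euler_integralS//; have := euler_integral_ge0 x.
by case: (euler_integral x) => [r _ _| |//]; rewrite ?ltry// gt0_muley ?lte_fin.
Qed.

Lemma Gamma_integralE x : Gamma_integral x = fine (euler_integral x).
Proof. by []. Qed.

Lemma Gamma_integralS x : 0 < x -> Gamma_integral (x + 1) = x * Gamma_integral x.
Proof.
move=> x0; rewrite !Gamma_integralE euler_integralS//.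
have := euler_integral_ge0 x; case: (euler_integral x) => [r| |]//= _.
by rewrite gt0_muley ?lte_fin// mulr0.
Qed.

Lemma Gamma_integral1 : Gamma_integral 1 = 1 :> R.
Proof. by rewrite Gamma_integralE euler_integral1. Qed.

(** Comparing exponents gives 1 = Gamma(1) <= Gamma(x) + Gamma(x + 1) = (1 + x) Gamma(x). *)
Lemma Gamma_integral_gt0 x : 0 < x <= 1 -> 0 < Gamma_integral x.
Proof.
move=> /[dup] x01 /andP[x0 x1].
have := @euler_integral_le_add x (x + 1) 1 ltac:(lra).
rewrite euler_integral1 euler_integralS// -(fineK (euler_integral_fin_num _ x01)).
rewrite -Gamma_integralE -EFinM -EFinD lee_fin => h.
rewrite ltNge; apply/negP => G0.
have : x * Gamma_integral x <= 0 by rewrite mulr_ge0_le0// ltW.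
lra.
Qed.

End GammaRecurrence.

(** * Recurrence for the Grunwald coefficients *)

Section GrunwaldCoefficients.
Context {R : realType}.
Implicit Types (alpha x : R) (k n : nat).

Lemma Gamma_gt0E x : 0 < x -> Gamma x = Gamma_integral x.
Proof. by rewrite /Gamma => ->. Qed.

Lemma Gamma_oppE alpha : 1 < alpha < 2 ->
  Gamma (- alpha) = Gamma_integral (2 - alpha) / (- alpha * (1 - alpha)).
Proof.
move=> a12; rewrite /Gamma ifF; last by apply/negbTE; rewrite -leNgt; lra.
rewrite opprK (_ : Num.truncn alpha = 1%N); last first.
  by apply: Num.Theory.truncn_def; lra.
by rewrite !big_ord_recr big_ord0/= mul1r addr0 (addrC _ 2) (addrC _ 1).
Qed.

Lemma Gamma_onemE alpha : 1 < alpha < 2 ->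
  Gamma (1 - alpha) = Gamma_integral (2 - alpha) / (1 - alpha).
Proof.
move=> a12; rewrite /Gamma ifF; last by apply/negbTE; rewrite -leNgt; lra.
rewrite (_ : Num.truncn _ = 0%N); last by apply: Num.Theory.truncn_def; lra.
rewrite big_ord_recr big_ord0/= mul1r addr0; congr (Gamma_integral _ / _); lra.
Qed.

(** For k = 0 and k = 1 the arguments fall into the continued branch of [Gamma], where everything
    reduces to Gamma(2 - alpha); from k = 2 on this is the functional equation of the integral. *)
Lemma Gamma_shift alpha k : 1 < alpha < 2 ->
  Gamma (k.+1%:R - alpha) = (k%:R - alpha) * Gamma (k%:R - alpha).
Proof.
move=> a12; case: k => [|[|k]].
- by rewrite sub0r Gamma_onemE// Gamma_oppE//; field; lra.
- by rewrite Gamma_onemE// Gamma_gt0E; [field|]; lra.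
have k0 : 0 <= k%:R :> R by [].
have kS : k.+2%:R = k%:R + 2 :> R by rewrite -addn2 natrD.
rewrite !Gamma_gt0E -?natr1 ?kS; [|lra|lra].
by rewrite -Gamma_integralS; [congr Gamma_integral|]; lra.
Qed.

Lemma Gamma_natS k : Gamma (k.+1%:R + 1) = k.+1%:R * Gamma (k%:R + 1) :> R.
Proof. by rewrite !Gamma_gt0E ?ltr_wpDl// -natr1 Gamma_integralS// ltr_wpDl. Qed.

Lemma Gamma_nat_gt0 k : 0 < Gamma (k%:R + 1) :> R.
Proof.
elim: k => [|k IHk]; first by rewrite add0r Gamma_gt0E// Gamma_integral1.
by rewrite Gamma_natS mulr_gt0.
Qed.

Lemma Gamma_opp_neq0 alpha : 1 < alpha < 2 -> Gamma (- alpha) != 0.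
Proof.
move=> a12; rewrite Gamma_oppE// mulf_neq0 ?invr_eq0//.
  by rewrite gt_eqF// Gamma_integral_gt0//; lra.
by rewrite mulf_neq0//; lra.
Qed.

Lemma g_coef0 alpha : 1 < alpha < 2 -> g_coef alpha 0 = 1.
Proof.
move=> a12; rewrite /g_coef sub0r add0r (@Gamma_gt0E 1)// Gamma_integral1 mulr1.
by rewrite divff// Gamma_opp_neq0.
Qed.

Lemma g_coefS alpha k : 1 < alpha < 2 ->
  k.+1%:R * g_coef alpha k.+1 = (k%:R - alpha) * g_coef alpha k.
Proof.
move=> a12; rewrite /g_coef Gamma_shift// Gamma_natS.
have := Gamma_opp_neq0 alpha a12; have := Gamma_nat_gt0 k.
have : k.+1%:R != 0 :> R by rewrite pnatr_eq0.
move: (Gamma (- alpha)) (Gamma (k%:R + 1)) (Gamma (k%:R - alpha)) k.+1%:R.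
by move=> p q r s s0 q0 p0; field; rewrite s0 p0 gt_eqF.
Qed.

End GrunwaldCoefficients.

(** * The generating function (1 - x)^alpha *)

Section GrunwaldGeneratingFunction.
Context {R : realType}.
Implicit Types (alpha x : R) (k n : nat).

Lemma g_coef1 alpha : 1 < alpha < 2 -> g_coef alpha 1 = - alpha.
Proof. by move=> a12; have := g_coefS alpha 0 a12; rewrite g_coef0//; lra. Qed.

Lemma g_coef2 alpha : 1 < alpha < 2 -> g_coef alpha 2 = alpha * (alpha - 1) / 2.
Proof. by move=> a12; have := g_coefS alpha 1 a12; rewrite g_coef1//; lra. Qed.

Lemma g_coef3 alpha : 1 < alpha < 2 ->
  g_coef alpha 3 = alpha * (alpha - 1) * (2 - alpha) / 6.
Proof. by move=> a12; have := g_coefS alpha 2 a12; rewrite g_coef2//; lra. Qed.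

Lemma g_coef_ge0 alpha k : 1 < alpha < 2 -> (2 <= k)%N -> 0 <= g_coef alpha k.
Proof.
move=> a12; elim: k => // k IHk; rewrite leq_eqVlt => /predU1P[<-|].
  by rewrite g_coef2//; apply: divr_ge0 => //; apply: mulr_ge0; lra.
rewrite ltnS => k2; rewrite -(@pmulr_rge0 _ k.+1%:R)// g_coefS//.
have k2' : 2 <= k%:R :> R by rewrite ler_nat.
by apply: mulr_ge0; [lra|exact: IHk].
Qed.

(** k g_k is nonincreasing from k = 2 on, since (k + 1) g_(k+1) = (k - alpha) g_k; its value at 2 is
    the bound. *)
Lemma natr_g_coef_le alpha k : 1 < alpha < 2 -> (2 <= k)%N ->
  k%:R * g_coef alpha k <= alpha * (alpha - 1).
Proof.
move=> a12; elim: k => // k IHk; rewrite leq_eqVlt => /predU1P[<-|].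
  by rewrite g_coef2//; lra.
rewrite ltnS => k2; rewrite g_coefS// (le_trans _ (IHk k2))//.
by apply: ler_wpM2r; [exact: g_coef_ge0|lra].
Qed.

Definition g_sum alpha n x := \sum_(i < n) g_coef alpha i * x ^+ i.

(** By the recurrence, the derivative of [g_sum alpha n.+1] with its index shifted back to 0. *)
Definition g_sum_deriv alpha n x :=
  \sum_(i < n) (i%:R - alpha) * g_coef alpha i * x ^+ i.

(** (1 - x)^alpha solves (1 - x) f' + alpha f = 0; the truncated series misses this by a single
    boundary term. *)
Lemma g_sum_ode alpha n x : 1 < alpha < 2 ->
  (1 - x) * g_sum_deriv alpha n x + alpha * g_sum alpha n.+1 x
  = (alpha - n%:R) * g_coef alpha n * x ^+ n.
Proof.
move=> a12; elim: n => [|n IHn].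
  by rewrite /g_sum_deriv big_ord0 mulr0 /g_sum big_ord_recr big_ord0/= subr0 !add0r; lra.
rewrite /g_sum_deriv big_ord_recr/= /g_sum big_ord_recr/= -/(g_sum alpha n.+1 x).
rewrite -/(g_sum_deriv alpha n x) mulrDr mulrDr addrACA IHn exprS.
have -> : (alpha - n.+1%:R) * g_coef alpha n.+1 * (x * x ^+ n) =
    alpha * (g_coef alpha n.+1 * (x * x ^+ n))
    - (n.+1%:R * g_coef alpha n.+1) * (x * x ^+ n) by lra.
by rewrite g_coefS//; lra.
Qed.

Lemma is_derive_g_sum alpha n x : 1 < alpha < 2 ->
  is_derive x 1 (g_sum alpha n.+1) (g_sum_deriv alpha n x).
Proof.
move=> a12; elim: n => [|n IHn].
  have -> : g_sum alpha 1 = cst (g_coef alpha 0).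
    by apply/funext => y; rewrite /g_sum big_ord_recr big_ord0/= add0r expr0 mulr1.
  by rewrite /g_sum_deriv big_ord0; exact: is_derive_cst.
have -> : g_sum alpha n.+2 =
    g_sum alpha n.+1 \+ (fun y => g_coef alpha n.+1 * y ^+ n.+1).
  by apply/funext => y; rewrite /g_sum big_ord_recr.
rewrite /g_sum_deriv big_ord_recr/= -g_coefS// (mulrC n.+1%:R).
rewrite -(mulrA (g_coef alpha n.+1)).
by apply: is_deriveD; exact: is_derive_monomial.
Qed.

(** S (1 - x)^(-alpha) equals 1 at x = 0, and by [g_sum_ode] its derivative contains only the
    boundary term; the mean value theorem then gives geometric decay of the error. *)
Lemma g_sum_powR_bound alpha n x : 1 < alpha < 2 -> 0 < x < 1 -> (2 <= n)%N ->
  `|g_sum alpha n.+1 x * (1 - x) `^ (- alpha) - 1|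
    <= (1 - x) `^ (- alpha - 1) * (alpha * (alpha - 1)) * x ^+ n.
Proof.
move=> a12 x01 n2.
pose D (y : R) := g_sum alpha n.+1 y * (1 - y) `^ (- alpha).
pose D' (y : R) := (1 - y) `^ (- alpha - 1) * ((alpha - n%:R) * g_coef alpha n * y ^+ n).
have dD (y : R) : y < 1 -> is_derive y 1 D (D' y).
  move=> y1; have dS := is_derive_g_sum alpha n y a12.
  have y10 : 0 < 1 - y by lra.
  have dB : is_derive y 1 (fun z : R => 1 - z) (-1).
    by apply: is_derive_eq; rewrite add0r mul1r.
  have dP : is_derive y 1 (fun z => (1 - z) `^ (- alpha))
      (- alpha * (1 - y) `^ (- alpha - 1) * -1).
    have dP1 := is_derive1_powR (- alpha) y10.
    exact: (@is_derive1_comp R (fun z => z `^ (- alpha)) (fun z => 1 - z) y _ _ dP1 dB).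
  rewrite /D; apply: is_derive_eq; rewrite /GRing.scale/= /D' -g_sum_ode//.
  have -> : (1 - y) `^ (- alpha) = (1 - y) * (1 - y) `^ (- alpha - 1).
    rewrite -{2}(powRr1 (ltW y10)) -powRD; first by congr (_ `^ _); lra.
    by apply/implyP => _; rewrite gt_eqF.
  lra.
have D0 : D 0 = 1.
  rewrite /D /g_sum subr0 powR1 mulr1 big_ord_recl expr0 mulr1 g_coef0//.
  by rewrite big1 ?addr0// => i _; rewrite expr0n/= mulr0.
rewrite -[X in _ - X]D0 -/(D x).
have [c xc ->] : exists2 c, c \in `]0, x[%R & D x - D 0 = D' c * (x - 0).
  apply: MVT => [|y|]; first by case/andP: x01.
    by rewrite in_itv/= => /andP[_ yx]; apply: dD; lra.
  apply: derivable_within_continuous => y; rewrite in_itv/= => /andP[_ yx].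
  by have /(_ ltac:(lra))[] := dD y.
rewrite in_itv/= in xc; rewrite subr0.
have n2' : 2 <= n%:R :> R by rewrite ler_nat.
have g0 := g_coef_ge0 alpha n a12 n2.
have pc : 0 <= (1 - c) `^ (- alpha - 1) <= (1 - x) `^ (- alpha - 1).
  rewrite powR_ge0/= -opprD !powRN lef_pV2 ?posrE ?powR_gt0//; [|lra|lra].
  by apply: ge0_ler_powR; rewrite ?nnegrE; lra.
have gc : 0 <= (n%:R - alpha) * g_coef alpha n <= alpha * (alpha - 1).
  rewrite mulr_ge0//=; last by lra.
  apply: le_trans (natr_g_coef_le alpha n a12 n2).
  by apply: ler_wpM2r => //; lra.
have xc' : 0 <= c ^+ n * x <= x ^+ n.
  have cn0 : 0 <= c ^+ n by apply: exprn_ge0; lra.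
  rewrite mulr_ge0//=; last by lra.
  have : c ^+ n <= x ^+ n by apply: lerXn2r; rewrite ?nnegrE; lra.
  have : 0 <= c ^+ n * (1 - x) by apply: mulr_ge0 => //; lra.
  by lra.
have -> : D' c * x = - ((1 - c) `^ (- alpha - 1) *
    ((n%:R - alpha) * g_coef alpha n) * (c ^+ n * x)) by rewrite /D'; lra.
case/andP: pc => pc0 pc1; case/andP: gc => gc0 gc1; case/andP: xc' => xc0 xc1.
rewrite normrN ger0_norm; last first.
  by apply: mulr_ge0 => //; exact: mulr_ge0.

by apply: ler_pM => //; [exact: mulr_ge0|exact: ler_pM].
Qed.

Lemma g_sum_cvg alpha x : 1 < alpha < 2 -> 0 < x < 1 ->
  (g_sum alpha n x @[n --> \oo] --> (1 - x) `^ alpha)%classic.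
Proof.
move=> a12 x01; rewrite -(@cvg_shiftS R).
have x10 : 0 < 1 - x by lra.
have geo : ((x ^+ n : R) @[n --> \oo] --> (0 : R))%classic.
  by apply: cvg_expr; rewrite gtr0_norm; lra.
pose C := (1 - x) `^ (- alpha - 1) * (alpha * (alpha - 1)).
have lim1 : ((g_sum alpha n.+1 x * (1 - x) `^ (- alpha) - 1) @[n --> \oo] --> (0 : R))%classic.
  apply/norm_cvg0P; apply: (@squeeze_cvgr _ _ _ _ (cst 0) (fun n => C * x ^+ n)).
  - near=> n; rewrite normr_ge0/=; apply: g_sum_powR_bound => //.
    by near: n; exact: nbhs_infty_ge.
  - exact: cvg_cst.
  - by rewrite -(mulr0 C); apply: cvgMr.
have -> : (fun n => g_sum alpha n.+1 x) =
    (fun n => (1 - x) `^ alpha * (g_sum alpha n.+1 x * (1 - x) `^ (- alpha) - 1)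
      + (1 - x) `^ alpha).
  apply/funext => n; rewrite powRN mulrBr mulr1 subrK mulrCA divff ?mulr1//.
  by rewrite gt_eqF// powR_gt0.
set p := (1 - x) `^ alpha.
suff : (p * (g_sum alpha n.+1 x * (1 - x) `^ (- alpha) - 1) + p @[n --> \oo]
    --> p * 0 + p)%classic by rewrite mulr0 add0r.
by apply: cvgD; [exact: cvgMr|exact: cvg_cst].
Unshelve. all: by end_near. Qed.

End GrunwaldGeneratingFunction.

(** * Signs and partial sums of the weights without exponentials *)

Section BaseWeights.
Context {R : realType}.
Implicit Types (alpha lambda h x y d p : R) (k n : nat).

Definition base_weight alpha k : R :=
  match k with
  | 0%N => mu_1 alpha * g_coef alpha 0
  | 1%N => mu_1 alpha * g_coef alpha 1 + mu_0 alpha * g_coef alpha 0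
  | (j.+2)%N =>
      mu_1 alpha * g_coef alpha j.+2 + mu_0 alpha * g_coef alpha j.+1
        + mu_m1 alpha * g_coef alpha j
  end.

Lemma weightE alpha lambda h k :
  weight alpha lambda h k = base_weight alpha k * expR ((1 - k%:R) * lambda * h).
Proof.
case: k => [|[|k]]//=; first by rewrite subr0 mul1r.
by rewrite subrr !mul0r expR0 mulr1.
Qed.

(* For s = k - 2 - alpha, the bracket left once the recurrence has been used
   to factor g_(k-2) out of the k-th weight. *)
Lemma base_weight_bracket_ge0 d (t s m : R) : 0 <= d <= 1 -> 0 <= t ->
  s = t + 1 - d -> m = t + 4 \/ m = t + 3 ->
  0 <= mu_1 (1 + d) * (s * (s + 1)) + mu_0 (1 + d) * (s * m)
     + mu_m1 (1 + d) * (m * (m - 1)).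
Proof.
move=> d01 t0 -> mE; rewrite /mu_1 /mu_0 /mu_m1.
have d2 : 0 <= d * (1 - d) by apply: mulr_ge0; lra.
have d3 : 0 <= d ^+ 2 * (1 - d) by apply: mulr_ge0; [exact: sqr_ge0|lra].
have d30 : 0 <= d ^+ 3 by apply: exprn_ge0; lra.
have d40 : 0 <= d ^+ 4 by apply: exprn_ge0; lra.
have td : 0 <= t * (1 - d) by apply: mulr_ge0; lra.
have td2 : 0 <= t * (d * (1 - d)) by apply: mulr_ge0.
have td3 : 0 <= t * d ^+ 3 by apply: mulr_ge0.
(* For t = 0 and m = 3 the bracket, a quartic in d, is smallest near d = 9/10; hence the centre of
   these squares. *)
have dq := sqr_ge0 (d - 9 / 10).
have dc : 0 <= d * (d - 9 / 10) ^+ 2 by apply: mulr_ge0; lra.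
have tt : 0 <= t ^+ 2 by exact: sqr_ge0.
by case: mE => ->; lra.
Qed.

Lemma g_coefS_div alpha k : 1 < alpha < 2 ->
  g_coef alpha k.+1 = (k%:R - alpha) / k.+1%:R * g_coef alpha k.
Proof.
move=> a12; have k0 : k.+1%:R != 0 :> R by rewrite pnatr_eq0.
apply: (mulfI k0); rewrite g_coefS//.
by move: k.+1%:R k0 => q q0; field.
Qed.

Lemma base_weight_ge0 alpha k : 1 < alpha < 2 -> (4 <= k)%N ->
  0 <= base_weight alpha k.
Proof.
move=> a12; case: k => [|[|[|[|k]]]]// _ /=.
rewrite (g_coefS_div alpha k.+3)// (g_coefS_div alpha k.+2)//.
have g0 := g_coef_ge0 alpha k.+2 a12 isT.
set t : R := k%:R; have t0 : 0 <= t by [].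
have -> : k.+2%:R = t + 2 by rewrite -addn2 natrD.
have -> : k.+3%:R = t + 3 by rewrite -addn3 natrD.
have -> : k.+4%:R = t + 4 by rewrite -addn4 natrD.
have := @base_weight_bracket_ge0 (alpha - 1) t (t + 2 - alpha) (t + 4) ltac:(lra) t0
  ltac:(lra) (or_introl erefl).
rewrite (addrC 1) subrK => B.
have -> : mu_1 alpha * ((t + 3 - alpha) / (t + 4) *
      ((t + 2 - alpha) / (t + 3) * g_coef alpha k.+2)) +
    mu_0 alpha * ((t + 2 - alpha) / (t + 3) * g_coef alpha k.+2) +
    mu_m1 alpha * g_coef alpha k.+2 =
  g_coef alpha k.+2 / ((t + 3) * (t + 4)) *
   (mu_1 alpha * ((t + 2 - alpha) * (t + 2 - alpha + 1)) +
    mu_0 alpha * ((t + 2 - alpha) * (t + 4)) +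
    mu_m1 alpha * ((t + 4) * (t + 4 - 1))).
  by field; rewrite !gt_eqF; lra.
by apply: mulr_ge0 => //; apply: divr_ge0 => //; apply: mulr_ge0; lra.
Qed.

Lemma base_weight_sumE alpha n x :
  \sum_(k < n.+2) base_weight alpha k * x ^+ k =
  mu_1 alpha * g_sum alpha n.+2 x + mu_0 alpha * x * g_sum alpha n.+1 x
  + mu_m1 alpha * x ^+ 2 * g_sum alpha n x.
Proof.
elim: n => [|n IHn].
  by rewrite /g_sum !big_ord_recr !big_ord0/=; lra.
rewrite big_ord_recr/= IHn /g_sum !big_ord_recr/=.
by rewrite (exprSr x n.+1) (exprSr x n); lra.
Qed.

(** From index 4 on the weights are nonnegative, so the partial sums increase towards the generating
    function and stay below it. *)
Lemma base_weight_sum_le alpha n x : 1 < alpha < 2 -> 0 < x < 1 -> (4 <= n)%N ->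
  \sum_(k < n) base_weight alpha k * x ^+ k <=
  (1 - x) `^ alpha * (mu_1 alpha + mu_0 alpha * x + mu_m1 alpha * x ^+ 2).
Proof.
move=> a12 x01 n4.
pose u m := \sum_(k < m + n) base_weight alpha k * x ^+ k.
have u_nd : nondecreasing_seq u.
  apply/nondecreasing_seqP => m; rewrite /u addSn big_ord_recr/= lerDl.
  rewrite mulr_ge0//; last by apply: exprn_ge0; lra.
  by apply: base_weight_ge0 => //; lia.
set l := (_ `^ _ * _).
suff u_cvg : (u m @[m --> \oo] --> l)%classic.
  rewrite -(cvg_lim (@Rhausdorff R) u_cvg).
  by have := nondecreasing_cvgn_le u_nd (cvgP _ u_cvg) 0%N; rewrite /u add0n.
rewrite (@cvg_shiftn n R (fun m => \sum_(k < m) base_weight alpha k * x ^+ k)).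
rewrite -(@cvg_shiftn 2 R).
have -> : (fun m => \sum_(k < m + 2) base_weight alpha k * x ^+ k) = (fun m =>
  mu_1 alpha * g_sum alpha (m + 2) x + mu_0 alpha * x * g_sum alpha (m + 1) x
  + mu_m1 alpha * x ^+ 2 * g_sum alpha m x).
  by apply/funext => m; rewrite addn2 addn1 base_weight_sumE.
have S := g_sum_cvg alpha x a12 x01.
have -> : l = mu_1 alpha * (1 - x) `^ alpha + mu_0 alpha * x * (1 - x) `^ alpha
   + mu_m1 alpha * x ^+ 2 * (1 - x) `^ alpha by rewrite /l; lra.
apply: cvgD; last exact: cvgMr.
by apply: cvgD; apply: cvgMr; rewrite (@cvg_shiftn _ R (fun m => g_sum alpha m x)).
Qed.

(** At x = 1 the relation [g_sum_ode] loses its derivative term and gives each partial sum of the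
    g_k in closed form. The sum of weights becomes a negative multiple of g_(n+2) times the bracket
    with m = t + 3. *)
Lemma base_weight_sum1_le0 alpha n : 1 < alpha < 2 -> (4 <= n)%N ->
  \sum_(k < n) base_weight alpha k <= 0.
Proof.
move=> a12; case: n => [|[|[|[|n]]]]// _.
have S m : alpha * g_sum alpha m.+1 1 = (alpha - m%:R) * g_coef alpha m.
  by have := g_sum_ode alpha m 1 a12; rewrite subrr mul0r add0r expr1n mulr1.
have := base_weight_sumE alpha n.+2 1.
under eq_bigr do rewrite expr1n mulr1.
move=> ->; rewrite expr1n !mulr1.
have g0 := g_coef_ge0 alpha n.+2 a12 isT.
have S1 := S n.+3; have S2 := S n.+2; have S3 := S n.+1.
have G2 := g_coefS alpha n.+1 a12; have G3 := g_coefS_div alpha n.+2 a12.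
set t : R := n%:R; have t0 : 0 <= t by [].
have E1 : n.+1%:R = t + 1 by rewrite -addn1 natrD.
have E2 : n.+2%:R = t + 2 by rewrite -addn2 natrD.
have E3 : n.+3%:R = t + 3 by rewrite -addn3 natrD.
rewrite E1 E2 E3 in S1 S2 S3 G2 G3.
have := @base_weight_bracket_ge0 (alpha - 1) t (t + 2 - alpha) (t + 3) ltac:(lra) t0
  ltac:(lra) (or_intror erefl).
rewrite (addrC 1) subrK => B.
rewrite -(@pmulr_rle0 _ alpha); last by lra.
have -> : alpha * (mu_1 alpha * g_sum alpha n.+4 1 + mu_0 alpha * g_sum alpha n.+3 1 +
    mu_m1 alpha * g_sum alpha n.+2 1) =
  mu_1 alpha * (alpha * g_sum alpha n.+4 1) + mu_0 alpha * (alpha * g_sum alpha n.+3 1) +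
    mu_m1 alpha * (alpha * g_sum alpha n.+2 1) by lra.
have S3' : alpha * g_sum alpha n.+2 1 = - ((t + 2) * g_coef alpha n.+2).
  by rewrite S3 G2; lra.
rewrite S1 S2 S3' G3.
have -> : mu_1 alpha * ((alpha - (t + 3)) * ((t + 2 - alpha) / (t + 3) * g_coef alpha n.+2)) +
  mu_0 alpha * ((alpha - (t + 2)) * g_coef alpha n.+2) +
  mu_m1 alpha * - ((t + 2) * g_coef alpha n.+2) =
  - (g_coef alpha n.+2 / (t + 3) *
   (mu_1 alpha * ((t + 2 - alpha) * (t + 2 - alpha + 1)) +
    mu_0 alpha * ((t + 2 - alpha) * (t + 3)) +
    mu_m1 alpha * ((t + 3) * (t + 3 - 1)))).
  by field; rewrite gt_eqF; lra.
by rewrite oppr_le0; apply: mulr_ge0 => //; apply: divr_ge0 => //; lra.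
Qed.

(** Here h, p, x, y stand for H = lambda h, H^(alpha-1), exp H and exp (- H). The link x - y <= h (x
    + y) is tanh H <= H. *)
Lemma base_weight02_ge0 d h p x y : 0 < d < 1 -> 0 <= h <= 1 -> 0 <= p <= 1 ->
  1 <= x -> 0 <= y <= 1 -> x - y <= h * (x + y) ->
  let a02 := base_weight (1 + d) 0%N * x + base_weight (1 + d) 2%N * y - (1 + d) / 2 * p * (x - y)
             + d * h * p * (x + y) / 6 in
  0 <= a02 /\ 0 <= a02 + 4 * (base_weight (1 + d) 3%N * y ^+ 2).
Proof.
move=> d01 h01 p01 x1 y01 xy a02.
have a12 : 1 < 1 + d < 2 by lra.
have g0 := g_coef0 _ a12; have g1 := g_coef1 _ a12.
have g2 := g_coef2 _ a12; have g3 := g_coef3 _ a12.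
(* The tanh inequality trades the term with h for one in x - y; the result decreases in p, so p = 1
   is the worst case. *)
have lin : (d + d ^+ 2) / 8 * x
    + (11 * d + 305 / 10 * d ^+ 2 + 13 * d ^+ 3 + 3 / 2 * d ^+ 4) / 24 * y <= a02.
  have q : 0 <= p * (d / 6) * (h * (x + y) - (x - y)).
    by apply: mulr_ge0; [apply: mulr_ge0|]; lra.
  have r : 0 <= (1 - p) * ((1 + 2 / 3 * d) * (x - y)).
    by apply: mulr_ge0; [|apply: mulr_ge0]; lra.
  have d12 : (1 + d) / 2 - d / 6 - (1 + 2 / 3 * d) / 2 = 0 by lra.
  rewrite /a02 /= g0 g1 g2 /mu_1 /mu_0 /mu_m1; clear -q r; lra.
have d2 : 0 <= d ^+ 2 by exact: sqr_ge0.
have d3 : 0 <= d ^+ 3 by apply: exprn_ge0; lra.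
have d4 : 0 <= d ^+ 4 by apply: exprn_ge0; lra.
have dx : 0 <= (d + d ^+ 2) / 8 * (x - y) by apply: mulr_ge0; lra.
have dy : 0 <= (11 * d + 305 / 10 * d ^+ 2 + 13 * d ^+ 3 + 3 / 2 * d ^+ 4) / 24 * y.
  by apply: mulr_ge0; lra.
have dyy : 0 <= (d + d ^+ 2) / 8 * y by apply: mulr_ge0; lra.
have a020 : 0 <= a02 by clear -lin dx dy dyy; lra.
split=> //.
have [b3|b3] := leP 0 (base_weight (1 + d) 3%N).
  by apply: addr_ge0 => //; apply: mulr_ge0 => //; apply: mulr_ge0 => //; exact: sqr_ge0.
have y2 : base_weight (1 + d) 3%N * y <= base_weight (1 + d) 3%N * y ^+ 2.
  by apply: ler_wnM2l; [exact: ltW|rewrite expr2; apply: ler_piMl; lra].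
suff : 0 <= ((d + d ^+ 2) / 8 +
    (11 * d + 305 / 10 * d ^+ 2 + 13 * d ^+ 3 + 3 / 2 * d ^+ 4) / 24 +
    4 * base_weight (1 + d) 3%N) * y by clear -lin dx y2; lra.
apply: mulr_ge0; last by lra.
have e1 : 0 <= d * (1 - d) by apply: mulr_ge0; lra.
have e2 : 0 <= d ^+ 2 * (1 - d) by apply: mulr_ge0 => //; lra.
have e3 : 0 <= d ^+ 3 * (1 - d) by apply: mulr_ge0 => //; lra.
have e4 : 0 <= d ^+ 4 * (1 - d) by apply: mulr_ge0 => //; lra.
rewrite /= g1 g2 g3 /mu_1 /mu_0 /mu_m1; clear -d01 d2 d3 d4 e1 e2 e3 e4; lra.
Qed.

End BaseWeights.

(** * Nonpositivity of the space operator *)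

Section SpaceOperator.
Context {R : realType}.
Implicit Types (alpha lambda h : R) (V : nat -> R) (i k n M : nat).

(* The coefficient of V_(i+1-k) in h^alpha times the space operator: the
   derivative term contributes to k = 0, 2 and the compact one to k = 0, 1, 2. *)
Definition space_coef alpha lambda h k : R :=
  let H := lambda * h in let p := H `^ (alpha - 1) in
  weight alpha lambda h k +
  match k with
  | 0%N => expR H * p * ((alpha - 1) * H / 6 - alpha / 2)
  | 1%N => 2 / 3 * (alpha - 1) * H * p
  | 2%N => expR (- H) * p * ((alpha - 1) * H / 6 + alpha / 2)
  | _ => 0
  end.

Lemma space_opE alpha lambda h V i : 1 < alpha < 2 -> 0 <= lambda -> 0 < h ->
  (0 < i)%N ->
  space_op alpha lambda h V i =
  (h `^ alpha)^-1 *
    \sum_(0 <= k < i.+2) space_coef alpha lambda h k * V (i.+1 - k)%N.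
Proof.
move=> a12 l0 h0; case: i => // i _.
have split3 (b : nat -> R) : \sum_(0 <= k < i.+3) b k =
    b 0%N + b 1%N + b 2%N + \sum_(3 <= k < i.+3) b k.
  by rewrite (@big_cat_nat _ _ _ 3)//= big_mkord !big_ord_recr big_ord0/= add0r.
rewrite /space_op /compact_op.
rewrite (split3 (fun k => weight alpha lambda h k * V (i.+2 - k)%N)).
rewrite (split3 (fun k => space_coef alpha lambda h k * V (i.+2 - k)%N)).
have -> : \sum_(3 <= k < i.+3) space_coef alpha lambda h k * V (i.+2 - k)%N =
    \sum_(3 <= k < i.+3) weight alpha lambda h k * V (i.+2 - k)%N.
  rewrite !big_nat; apply: eq_bigr => k /andP[k3 _]; congr (_ * _).
  by case: k k3 => [|[|[|k]]]//; rewrite /space_coef addr0.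
rewrite subn0 subn1 subn2 -[i.+2.-1]/i.+1 -[i.+2.-2]/i.
have hh : h `^ alpha = h * h `^ (alpha - 1) by rewrite mulr_powRB1 ?ltW//; lra.
have ll : lambda `^ alpha = lambda * lambda `^ (alpha - 1).
  by rewrite mulr_powRB1//; lra.
rewrite /space_coef.
move: (weight alpha lambda h 0) (weight alpha lambda h 1) (weight alpha lambda h 2).
move: (\sum_(3 <= k < i.+3) _) => S w0 w1 w2 /=.
rewrite powRM ?(ltW h0)// ll hh.
have : h `^ (alpha - 1) != 0 by rewrite gt_eqF// powR_gt0.
have : h != 0 by rewrite gt_eqF.
move: (h `^ (alpha - 1)) (lambda `^ (alpha - 1)) (expR (lambda * h)) (expR (- (lambda * h))).
move=> q r x y hn qn.
by field; rewrite hn qn.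
Qed.

(** For lambda > 0 the weights sum to exp H times the base series at y = exp (- H), bounded by its
    limit. Writing 1 - y = H u pulls out H^alpha and leaves the expression of
    [scaled_symbol_sum_le0]. For lambda = 0 the series is taken at x = 1. *)
Lemma space_coef_sum_le0 alpha lambda h n : 1 < alpha < 2 -> 0 <= lambda ->
  0 < h -> lambda * h <= 1 -> (4 <= n)%N ->
  \sum_(k < n) space_coef alpha lambda h k <= 0.
Proof.
move=> a12 l0 h0; set H := lambda * h => H1 n4.
have -> : \sum_(k < n) space_coef alpha lambda h k =
    \sum_(k < n) weight alpha lambda h k + H `^ (alpha - 1) *
    ((alpha - 1) * H * (2 / 3 + (expR H + expR (- H)) / 6)
     - alpha / 2 * (expR H - expR (- H))).
  rewrite big_split/=; congr (_ + _).
  rewrite -(big_mkord xpredT (fun k => match k with 0%N => _ | _ => _ end)).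
  rewrite (@big_cat_nat _ _ _ 3)//=; last exact: ltnW.
  rewrite [X in _ + X]big_nat [X in _ + X]big1; last by case=> [|[|[|k]]].
  by rewrite addr0 big_mkord !big_ord_recr big_ord0/= -/H; lra.
move: l0; rewrite le_eqVlt => /predU1P[l0|l0].
  have -> : H = 0 by rewrite /H -l0 mul0r.
  have a10 : alpha - 1 != 0 by rewrite gt_eqF//; lra.
  rewrite (powR0 a10) mul0r addr0.
  rewrite (eq_bigr (fun k : 'I_n => base_weight alpha k)); last first.
    by move=> k _; rewrite weightE -l0 mulr0 mul0r expR0 mulr1.
  exact: base_weight_sum1_le0.
have H0 : 0 < H by exact: mulr_gt0.
set x := expR H; set y := expR (- H).
have xy : x * y = 1 by rewrite -expRD subrr expR0.
have y01 : 0 < y < 1 by rewrite expR_gt0 expR_lt1; lra.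
have -> : \sum_(k < n) weight alpha lambda h k =
    x * \sum_(k < n) base_weight alpha k * y ^+ k.
  rewrite mulr_sumr; apply: eq_bigr => k _.
  rewrite weightE mulrCA; congr (_ * _).
  rewrite /x /y -expRM_natl -expRD -mulrA -/H mulrBl mul1r mulrN.
  by [].
have := @base_weight_sum_le _ alpha n y a12 y01 n4.
move/(ler_wpM2l (expR_ge0 H)); rewrite -/x.
have := @scaled_symbol_sum_le0 R (alpha - 1) H ltac:(lra) ltac:(lra).
rewrite -/x -/y /= => E F.
set u := (1 - y) / H in E.
have u0 : 0 < u by apply: divr_gt0; lra.
have HuE : 1 - y = H * u by rewrite /u mulrC divfK// gt_eqF.
have HA : H `^ alpha = H * H `^ (alpha - 1) by rewrite mulr_powRB1 ?ltW//; lra.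
have uA : u `^ alpha = u * u `^ (alpha - 1) by rewrite mulr_powRB1 ?ltW//; lra.
rewrite HuE powRM ?(ltW H0) ?(ltW u0)// HA uA in F.
set p := H `^ (alpha - 1) in F *.
set w := u `^ (alpha - 1) in E F *.
have pH : 0 <= p * H by apply: mulr_ge0; [exact: powR_ge0|exact: ltW].
have {E} := mulr_ge0_le0 pH E.
have -> : (x - y) / (2 * H) = (x - y) / 2 / H by field; rewrite gt_eqF.
move=> E.
have : p * H * (w * (u * (mu_1 alpha * x + mu_0 alpha + mu_m1 alpha * y))
    - alpha * ((x - y) / 2 / H) + (alpha - 1) * (2 / 3 + (x + y) / 6)) <= 0.
  apply: le_trans E; rewrite le_eqVlt; apply/orP; left; apply/eqP.
  congr (_ * (_ * (_ * _) - _ * _ + _)); last by lra.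
  by rewrite /mu_1 /mu_0 /mu_m1; lra.
have -> : p * H * (w * (u * (mu_1 alpha * x + mu_0 alpha + mu_m1 alpha * y))
    - alpha * ((x - y) / 2 / H) + (alpha - 1) * (2 / 3 + (x + y) / 6)) =
  p * H * (w * (u * (mu_1 alpha * x + mu_0 alpha + mu_m1 alpha * y)))
  + p * ((alpha - 1) * H * (2 / 3 + (x + y) / 6) - alpha / 2 * (x - y)).
  by field; rewrite gt_eqF.
have -> : p * H * (w * (u * (mu_1 alpha * x + mu_0 alpha + mu_m1 alpha * y))) =
  x * (H * p * (u * w) * (mu_1 alpha + mu_0 alpha * y + mu_m1 alpha * y ^+ 2)).
  have -> : x * (H * p * (u * w) * (mu_1 alpha + mu_0 alpha * y + mu_m1 alpha * y ^+ 2))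
    = H * p * (u * w) * (mu_1 alpha * x + mu_0 alpha * (x * y)
      + mu_m1 alpha * (x * y) * y) by lra.
  by rewrite xy; lra.
by move: F; clear; lra.
Qed.

Lemma space_coef_signs alpha lambda h : 1 < alpha < 2 -> 0 <= lambda * h <= 1 ->
  let a := space_coef alpha lambda h in
  [/\ forall k, (4 <= k)%N -> 0 <= a k, 0 <= a 0%N + a 2%N &
      0 <= a 0%N + a 2%N + 4 * a 3%N].
Proof.
move=> a12; set H := lambda * h => H01 a.
have [xl xu yl yu] := @expR_bounds R H H01.
have p01 : 0 <= H `^ (alpha - 1) <= 1.
  rewrite powR_ge0/=; apply: (@le_trans _ _ (1 `^ (alpha - 1))); last by rewrite powR1.
  by apply: ge0_ler_powR; rewrite ?nnegrE; lra.
have x1 : 1 <= expR H by rewrite -[1]expR0 ler_expR; lra.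
have y01 : 0 <= expR (- H) <= 1 by rewrite expR_ge0 expR_le1; lra.
have xy : expR H - expR (- H) <= H * (expR H + expR (- H)).
  have H2 : 0 <= H ^+ 3 by apply: exprn_ge0; lra.
  have H6 : 0 <= H ^+ 3 * (1 - H) by apply: mulr_ge0 => //; lra.
  have H7 : 0 <= H ^+ 4 * (1 - H).
    by apply: mulr_ge0; [apply: exprn_ge0|]; lra.
  have H8 : 0 <= H ^+ 5 * (1 - H).
    by apply: mulr_ge0; [apply: exprn_ge0|]; lra.
  have H5 : 0 <= H ^+ 5 by apply: exprn_ge0; lra.
  have : H * (2 + H ^+ 2) <= H * (expR H + expR (- H)).
    apply: ler_wpM2l; first by lra.
    have : 0 <= H ^+ 4 by apply: exprn_ge0; lra.
    by move: xl yl; clear; lra.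
  by move: xu yl H2 H6 H7 H8 H5; clear; lra.
have /= := @base_weight02_ge0 R (alpha - 1) H (H `^ (alpha - 1)) _ _
  ltac:(lra) H01 p01 x1 y01 xy.
rewrite (addrC 1) subrK.
have w0 : a 0%N = base_weight alpha 0 * expR H
    + expR H * H `^ (alpha - 1) * ((alpha - 1) * H / 6 - alpha / 2).
  by rewrite /a /space_coef weightE subr0 mul1r.
have w2 : a 2%N = base_weight alpha 2 * expR (- H)
    + expR (- H) * H `^ (alpha - 1) * ((alpha - 1) * H / 6 + alpha / 2).
  rewrite /a /space_coef weightE -/H; congr (_ * expR _ + _).
  by rewrite -mulrA -/H; lra.
have w3 : a 3%N = base_weight alpha 3 * expR (- H) ^+ 2.
  rewrite /a /space_coef weightE addr0 -expRM_natl; congr (_ * expR _).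
  by rewrite -mulrA -/H; lra.
move=> [A B]; split.
- move=> k k4; rewrite /a /space_coef weightE.
  have -> : (match k with 0%N => expR (lambda * h) * (lambda * h) `^ (alpha - 1) *
      ((alpha - 1) * (lambda * h) / 6 - alpha / 2)
    | 1%N => 2 / 3 * (alpha - 1) * (lambda * h) * (lambda * h) `^ (alpha - 1)
    | 2%N => expR (- (lambda * h)) * (lambda * h) `^ (alpha - 1) *
      ((alpha - 1) * (lambda * h) / 6 + alpha / 2) | _ => 0 end) = 0.
    by case: k k4 => [|[|[|[|k]]]].
  by rewrite addr0 mulr_ge0 ?expR_ge0// base_weight_ge0.
- by move: A; rewrite w0 w2 /base_weight; clear; lra.
- by move: B; rewrite w0 w2 w3 /base_weight; clear; lra.
Qed.

Lemma space_form_le0 alpha lambda h V M : 1 < alpha < 2 -> 0 <= lambda -> 0 < h ->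
  lambda * h <= 1 -> V 0%N = 0 -> V M = 0 ->
  \sum_(1 <= i < M) V i * space_op alpha lambda h V i <= 0.
Proof.
move=> a12 l0 h0 H1 V0 VM.
have H01 : 0 <= lambda * h <= 1 by rewrite mulr_ge0// ltW.
(* V is cut off at M because the convolution form ranges over indices beyond it: with length M + 2,
   exactly the indices from M on must carry zeros. *)
pose W i := if (i < M)%N then V i else 0.
have W0 : W 0%N = 0 by rewrite /W V0 if_same.
have WV i : (i <= M)%N -> W i = V i.
  by rewrite leq_eqVlt => /predU1P[->|iM]; rewrite /W ?ltnn ?VM// iM.
have WM i : (M <= i)%N -> W i = 0 by move=> Mi; rewrite /W ltnNge Mi.
pose F i := W i *
  (\sum_(0 <= k < i.+2) space_coef alpha lambda h k * W (i.+1 - k)%N).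
have -> : \sum_(1 <= i < M) V i * space_op alpha lambda h V i =
    (h `^ alpha)^-1 * \sum_(i < M.+2) F i.
  rewrite mulr_sumr -(big_mkord xpredT (fun i => (h `^ alpha)^-1 * F i)).
  rewrite [RHS](@big_cat_nat _ _ _ M)//=; last by rewrite leqW// leqW.
  rewrite [X in _ = _ + X]big_nat [X in _ = _ + X]big1 ?addr0; last first.
    by move=> i /andP[Mi _]; rewrite /F WM// mul0r mulr0.
  have [->|M0] := posnP M; first by rewrite !big_geq.
  rewrite [RHS]big_ltn// {1}/F W0 mul0r mulr0 add0r.
  rewrite !big_nat; apply: eq_bigr => i /andP[i0 iM].
  rewrite space_opE// mulrCA /F WV 1?ltnW//; congr (_ * (_ * _)).
  by apply: eq_bigr => k _; rewrite WV//; lia.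
apply: mulr_ge0_le0; first by rewrite invr_ge0 powR_ge0.
have [a4 a02 a023] := @space_coef_signs alpha lambda h a12 H01.
apply: convolution_form_le0 => //.
by move=> n; apply: space_coef_sum_le0.
Qed.

End SpaceOperator.

(** * Coercivity and boundedness of the compact operator *)

Section CompactForm.
Context {R : realType}.
Implicit Types (alpha lambda h : R) (F V W : nat -> R) (i k n M : nat).

Lemma compact_opB lambda h V W i :
  compact_op lambda h (fun j => V j - W j) i =
  compact_op lambda h V i - compact_op lambda h W i.
Proof. by rewrite /compact_op; lra. Qed.

Lemma space_opB alpha lambda h V W i :
  space_op alpha lambda h (fun j => V j - W j) i =
  space_op alpha lambda h V i - space_op alpha lambda h W i.
Proof.
rewrite /space_op compact_opB.
under eq_bigr do rewrite mulrBr.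
by rewrite sumrB; lra.
Qed.

Lemma sum_pred_le F M : F 0%N = 0 -> (forall i, 0 <= F i) ->
  \sum_(1 <= i < M) F i.-1 <= \sum_(1 <= i < M) F i.
Proof.
move=> F0 Fge0; rewrite big_add1/=; case: M => [|[|M]]/=; [by rewrite !big_geq|by rewrite !big_geq|].
rewrite [leLHS]big_ltn// F0 add0r [leRHS](@big_nat_recr _ _ _ M.+1)//= lerDl.
exact: Fge0.
Qed.

Lemma sum_succ_le F M : F M = 0 -> (forall i, 0 <= F i) ->
  \sum_(1 <= i < M) F i.+1 <= \sum_(1 <= i < M) F i.
Proof.
move=> FM Fge0; case: M FM => [|[|M]] FM; [by rewrite !big_geq|by rewrite !big_geq|].
rewrite [leLHS]big_nat_recr//= FM addr0.
rewrite -(big_add1 _ _ 1 M.+2 xpredT F)/=.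
by rewrite [X in _ <= X](@big_ltn _ _ _ 1)// lerDr.
Qed.

Lemma sum_mul_pred V W M : W 0%N = 0 -> V M = 0 ->
  \sum_(1 <= i < M) V i * W i.-1 = \sum_(1 <= i < M) V i.+1 * W i.
Proof.
move=> W0; case: M => [|[|M]] VM; [by rewrite !big_geq|by rewrite !big_geq|].
rewrite big_add1/= big_ltn// W0 mulr0 add0r.
by rewrite [RHS]big_nat_recr//= VM mul0r addr0.
Qed.

Lemma sum_mul_pred_bound V M : V 0%N = 0 -> V M = 0 ->
  `|\sum_(1 <= i < M) V i.+1 * V i| <= \sum_(1 <= i < M) V i ^+ 2.
Proof.
move=> V0 VM.
have S : \sum_(1 <= i < M) V i.+1 ^+ 2 <= \sum_(1 <= i < M) V i ^+ 2.
  by apply: (@sum_succ_le (fun i => V i ^+ 2)) => [|i]; rewrite ?VM ?expr0n// sqr_ge0.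
have P : 0 <= \sum_(1 <= i < M) (V i.+1 + V i) ^+ 2.
  by apply: sumr_ge0 => i _; exact: sqr_ge0.
have N : 0 <= \sum_(1 <= i < M) (V i.+1 - V i) ^+ 2.
  by apply: sumr_ge0 => i _; exact: sqr_ge0.
rewrite ler_norml; apply/andP; split.
  move: P; under eq_bigr do rewrite sqrrD.
  by rewrite !big_split/= ?sumrMnl; lra.
move: N; under eq_bigr do rewrite sqrrB.
by rewrite !big_split/= sumrN ?sumrMnl; lra.
Qed.

Lemma compact_formE lambda h V W M : V 0%N = 0 -> W M = 0 ->
  \sum_(1 <= i < M) W i * compact_op lambda h V i =
  1 / 6 * expR (- (lambda * h)) * (\sum_(1 <= i < M) W i.+1 * V i)
  + 2 / 3 * (\sum_(1 <= i < M) W i * V i)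
  + 1 / 6 * expR (lambda * h) * (\sum_(1 <= i < M) V i.+1 * W i).
Proof.
move=> V0 WM; rewrite -(sum_mul_pred W V)// !mulr_sumr -!big_split/=.
by apply: eq_bigr => i _; rewrite /compact_op; lra.
Qed.

(** 2 cosh 1 = 3.086...; what matters for coercivity is that the bound stays below 4. *)
Lemma expR_sum_le (x : R) : 0 <= x <= 1 -> expR x + expR (- x) <= 31 / 10.
Proof.
move=> x01; have [_ xu _ yu] := @expR_bounds R x x01.
have P k : 0 <= x ^+ k * (1 - x) by apply: mulr_ge0; [apply: exprn_ge0|]; lra.
have := P 0%N; have := P 1%N; have := P 2%N; have := P 3%N; have := P 4%N.
by have := P 5%N; rewrite expr0 expr1 mul1r; move: xu yu; clear; lra.
Qed.

(** The neighbour terms cost at most (31/10)/6 of the squared norm, leaving 2/3 - 31/60 = 3/20 >=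
    1/8. *)
Lemma compact_form_ge lambda h V M : 0 <= lambda * h <= 1 -> V 0%N = 0 -> V M = 0 ->
  1 / 8 * \sum_(1 <= i < M) V i ^+ 2
    <= \sum_(1 <= i < M) V i * compact_op lambda h V i.
Proof.
move=> H01 V0 VM; rewrite compact_formE//.
have := @sum_mul_pred_bound V M V0 VM; rewrite ler_norml => /andP[B _].
have xy := expR_sum_le _ H01.
set H := lambda * h in xy *.
set S := \sum_(1 <= i < M) V i.+1 * V i in B *.
set r := \sum_(1 <= i < M) V i ^+ 2 in B *.
have r0 : 0 <= r by apply: sumr_ge0 => i _; exact: sqr_ge0.
have xy0 : 0 <= expR H + expR (- H) by rewrite addr_ge0 ?expR_ge0.
have := mulr_ge0 xy0 (ltac:(clear -B; lra) : 0 <= S + r).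
have := mulr_ge0 (ltac:(clear -xy; lra) : 0 <= 31 / 10 - (expR H + expR (- H))) r0.
by move: r0; clear; lra.
Qed.

Lemma compact_form_le lambda h V W M : 0 <= lambda * h <= 1 -> V 0%N = 0 -> V M = 0 ->
  \sum_(1 <= i < M) W i * compact_op lambda h V i <=
  1 / 16 * \sum_(1 <= i < M) W i ^+ 2 + 6 * \sum_(1 <= i < M) V i ^+ 2.
Proof.
move=> H01 V0 VM; have xy := expR_sum_le _ H01.
(* The weight 1/20 keeps the W part below 1/16, half the coercivity constant 1/8, so that it can be
   absorbed; this yields the factor 6 / (1/16) = 96 <= 100 per implicit step. *)
have young (p q : R) : p * q <= 1 / 20 * p ^+ 2 + 5 * q ^+ 2.
  by have := sqr_ge0 (p - 10 * q); lra.
set x := expR (lambda * h) in xy; set y := expR (- (lambda * h)) in xy.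
have x0 : 0 <= x by exact: expR_ge0.
have y0 : 0 <= y by exact: expR_ge0.
set r := \sum_(1 <= i < M) V i ^+ 2.
set r' := \sum_(1 <= i < M) W i ^+ 2.
have r0 : 0 <= r by apply: sumr_ge0 => i _; exact: sqr_ge0.
have r'0 : 0 <= r' by apply: sumr_ge0 => i _; exact: sqr_ge0.
have Vsq i : 0 <= V i ^+ 2 by exact: sqr_ge0.
have rp : \sum_(1 <= i < M) V i.-1 ^+ 2 <= r.
  by apply: (@sum_pred_le (fun i => V i ^+ 2)) => //; rewrite V0 expr0n.
have rs : \sum_(1 <= i < M) V i.+1 ^+ 2 <= r.
  by apply: (@sum_succ_le (fun i => V i ^+ 2)) => //; rewrite VM expr0n.
have : \sum_(1 <= i < M) W i * compact_op lambda h V i <=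
    \sum_(1 <= i < M) ((y / 6 + 2 / 3 + x / 6) / 20 * W i ^+ 2
      + (y / 6 * 5 * V i.-1 ^+ 2 + 10 / 3 * V i ^+ 2 + x / 6 * 5 * V i.+1 ^+ 2)).
  apply: ler_sum => i _; rewrite /compact_op -/x -/y.
  have := ler_wpM2l y0 (young (W i) (V i.-1)).
  have := ler_wpM2l x0 (young (W i) (V i.+1)).
  by have := young (W i) (V i); clear; lra.
rewrite !big_split/= -!mulr_sumr -/r -/r'.
have := ler_wpM2l y0 rp; have := ler_wpM2l x0 rs.
have := mulr_ge0 (ltac:(clear -xy; lra) : 0 <= 31 / 10 - (x + y)) r0.
have := mulr_ge0 (ltac:(clear -xy; lra) : 0 <= 31 / 10 - (x + y)) r'0.
by move: r0 r'0; clear; lra.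
Qed.

End CompactForm.

(** * Growth of the error over one step and over all steps *)

Section OneStep.
Context {R : realType}.
Implicit Types (alpha lambda h c K tau : R) (V W e : nat -> R) (i k n M : nat).

Local Notation sqnorm M V := (\sum_(1 <= i < M) V i ^+ 2).

Lemma implicit_step_le alpha lambda h c M e e' :
  1 < alpha < 2 -> 0 <= lambda -> 0 < h -> lambda * h <= 1 -> 0 <= c ->
  e 0%N = 0 -> e M = 0 -> e' 0%N = 0 -> e' M = 0 ->
  (forall i, (1 <= i < M)%N ->
    compact_op lambda h e' i - c * space_op alpha lambda h e' i
    = compact_op lambda h e i) ->
  sqnorm M e' <= 100 * sqnorm M e.
Proof.
move=> a12 l0 h0 H1 c0 e0 eM e'0 e'M step.
have H01 : 0 <= lambda * h <= 1 by rewrite mulr_ge0// ltW.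
have S := space_form_le0 alpha lambda h e' M a12 l0 h0 H1 e'0 e'M.
have L := compact_form_ge lambda h e' M H01 e'0 e'M.
have U := compact_form_le lambda h e e' M H01 e0 eM.
have E : \sum_(1 <= i < M) e' i * compact_op lambda h e' i
    - c * (\sum_(1 <= i < M) e' i * space_op alpha lambda h e' i)
    = \sum_(1 <= i < M) e' i * compact_op lambda h e i.
  rewrite mulr_sumr -sumrB !big_nat; apply: eq_bigr => i iM.
  by rewrite -step//; lra.
have := mulr_ge0_le0 c0 S.
have : 0 <= sqnorm M e by apply: sumr_ge0 => i _; exact: sqr_ge0.
by move: L U E; clear; lra.
Qed.

(* In the variables exp (lambda x_i) e_i all the weights exp (lambda h k) of
   the scheme disappear. *)
Definition tilt lambda h e i : R := expR (lambda * h * i%:R) * e i.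

Lemma compact_op_tilt lambda h e i : (0 < i)%N ->
  expR (lambda * h * i%:R) * compact_op lambda h e i =
  compact_op 0 h (tilt lambda h e) i.
Proof.
case: i => // i _; rewrite /compact_op /tilt mul0r oppr0 expR0 /=.
have -> : lambda * h * i.+2%:R = lambda * h * i.+1%:R + lambda * h.
  by rewrite -[in LHS]natr1 mulrDr mulr1.
have -> : lambda * h * i%:R = lambda * h * i.+1%:R - lambda * h.
  by rewrite -natr1 mulrDr mulr1 addrK.
by rewrite !expRD; lra.
Qed.

Lemma space_op_tilt alpha lambda h e i : 1 < alpha < 2 -> (0 < i)%N ->
  let v := tilt lambda h e in
  expR (lambda * h * i%:R) * space_op alpha lambda h e i =
  space_op alpha 0 h v i
  - alpha * lambda `^ (alpha - 1) / (2 * h) * (v i.+1 - v i.-1)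
  + lambda `^ alpha * (alpha - 1) * compact_op 0 h v i.
Proof.
move=> a12 i0 v.
rewrite {1}/space_op mulrDr mulrBr.
have -> : expR (lambda * h * i%:R) *
    (lambda `^ alpha * (alpha - 1) * compact_op lambda h e i) =
    lambda `^ alpha * (alpha - 1) * compact_op 0 h v i.
  by rewrite -compact_op_tilt//; lra.
congr (_ + _); congr (_ - _).
  rewrite /space_op !powR0; [|by rewrite gt_eqF//; lra|by rewrite gt_eqF//; lra].
  rewrite mulr0 !mul0r subr0 addr0 mulrCA; congr (_ * _).
  rewrite mulr_sumr !big_nat; apply: eq_bigr => k /andP[_ ki].
  rewrite !weightE /v /tilt mulr0 mul0r expR0 mulr1.
  have -> : expR (lambda * h * (i.+1 - k)%:R) =
      expR (lambda * h * i%:R) * expR ((1 - k%:R) * lambda * h).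
    rewrite -expRD natrB; last by lia.
    by congr expR; rewrite -natr1; lra.
  lra.
case: i i0 => // i _; rewrite /v /tilt /=.
have -> : lambda * h * i.+2%:R = lambda * h * i.+1%:R + lambda * h.
  by rewrite -[in LHS]natr1 mulrDr mulr1.
have -> : lambda * h * i%:R = lambda * h * i.+1%:R - lambda * h.
  by rewrite -natr1 mulrDr mulr1 addrK.
by rewrite !expRD; lra.
Qed.

(** The bilinear form of the tridiagonal matrix with rows 1/6, 2/3, 1/6, the mass matrix of
    piecewise linear elements up to the factor h. *)
Definition energy h M V W : R := \sum_(1 <= i < M) W i * compact_op 0 h V i.

Lemma energyE h M V W : V 0%N = 0 -> W M = 0 ->
  energy h M V W = 1 / 6 * (\sum_(1 <= i < M) W i.+1 * V i)
  + 2 / 3 * (\sum_(1 <= i < M) W i * V i)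
  + 1 / 6 * (\sum_(1 <= i < M) V i.+1 * W i).
Proof.
by move=> V0 WM; rewrite /energy compact_formE// mul0r oppr0 expR0 !mulr1.
Qed.

Lemma energy_bounds h M V : V 0%N = 0 -> V M = 0 ->
  1 / 3 * sqnorm M V <= energy h M V V <= sqnorm M V.
Proof.
move=> V0 VM; have := sum_mul_pred_bound V M V0 VM.
rewrite ler_norml energyE//.
have -> : \sum_(1 <= i < M) V i * V i = sqnorm M V.
  by apply: eq_bigr => i _; rewrite expr2.
move: (\sum_(1 <= i < M) V i.+1 * V i) => S /andP[B1 B2].
by apply/andP; split; move: B1 B2; clear; lra.
Qed.

Lemma energy_cauchy h M V W : V 0%N = 0 -> V M = 0 -> W 0%N = 0 -> W M = 0 ->
  2 * energy h M V W <= energy h M V V + energy h M W W.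
Proof.
move=> V0 VM W0 WM.
have sym : energy h M W V = energy h M V W.
  rewrite !energyE//.
  under [X in 2 / 3 * X]eq_bigr do rewrite mulrC.
  by lra.
have VW0 : V 0%N - W 0%N = 0 by rewrite V0 W0 subrr.
have VWM : V M - W M = 0 by rewrite VM WM subrr.
have := energy_bounds h M (fun i => V i - W i) VW0 VWM.
have D0 : 0 <= sqnorm M (fun i => V i - W i).
  by apply: sumr_ge0 => i _; exact: sqr_ge0.
move=> /andP[D _].
have E : energy h M (fun i => V i - W i) (fun i => V i - W i) =
    energy h M V V - energy h M V W - energy h M W V + energy h M W W.
  rewrite /energy -!sumrB -big_split/=; apply: eq_bigr => i _.
  by rewrite compact_opB; lra.
by move: D D0; rewrite E sym; clear; lra.
Qed.

(** Testing with v' gives (1 - c tau) E(v', v') <= E(v, v'), and Cauchy's inequality bounds the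
    right side by the mean of E(v, v) and E(v', v'). *)
Lemma energy_step alpha lambda h K tau M e e' (c := K * (lambda `^ alpha * (alpha - 1))) :
  1 < alpha < 2 -> 0 <= lambda -> 0 < h -> 0 <= K -> 0 <= tau ->
  e 0%N = 0 -> e M = 0 -> e' 0%N = 0 -> e' M = 0 ->
  (forall i, (1 <= i < M)%N ->
    compact_op lambda h e' i - K * tau * space_op alpha lambda h e' i
    = compact_op lambda h e i) ->
  let v := tilt lambda h e in let v' := tilt lambda h e' in
  (1 - 2 * c * tau) * energy h M v' v' <= energy h M v v.
Proof.
move=> a12 l0 h0 K0 tau0 e0 eM e'0 e'M step /=.
set v := tilt lambda h e; set v' := tilt lambda h e'.
have v0 : v 0%N = 0 by rewrite /v /tilt e0 mulr0.
have vM : v M = 0 by rewrite /v /tilt eM mulr0.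
have v'0 : v' 0%N = 0 by rewrite /v' /tilt e'0 mulr0.
have v'M : v' M = 0 by rewrite /v' /tilt e'M mulr0.
have S : \sum_(1 <= i < M) v' i * space_op alpha 0 h v' i <= 0.
  by apply: space_form_le0 => //; rewrite mul0r.
have A : \sum_(1 <= i < M) v' i * (v' i.+1 - v' i.-1) = 0.
  under eq_bigr do rewrite mulrBr.
  rewrite sumrB sum_mul_pred//; apply/eqP; rewrite subr_eq0; apply/eqP.
  by apply: eq_bigr => i _; rewrite mulrC.
have E : energy h M v v' = (1 - c * tau) * energy h M v' v'
    - K * tau * (\sum_(1 <= i < M) v' i * space_op alpha 0 h v' i)
    + K * tau * (alpha * lambda `^ (alpha - 1) / (2 * h)) *
      (\sum_(1 <= i < M) v' i * (v' i.+1 - v' i.-1)).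
  rewrite /energy !mulr_sumr -sumrB -big_split/= !big_nat.
  apply: eq_bigr => i /[dup] /andP[i0 _] iM.
  rewrite -compact_op_tilt// -step// mulrBr compact_op_tilt//.
  have -> : expR (lambda * h * i%:R) * (K * tau * space_op alpha lambda h e' i) =
    K * tau * (expR (lambda * h * i%:R) * space_op alpha lambda h e' i) by lra.
  by rewrite space_op_tilt// -/v' /c; lra.
have Cs := energy_cauchy h M v v' v0 vM v'0 v'M.
have := mulr_ge0_le0 (mulr_ge0 K0 tau0) S.
by move: Cs; rewrite E A; clear; lra.
Qed.

(** The factor 3 undoes the lower energy bound 1/3, and exp (2 lambda h M) is the price of removing
    the tilt; as h M = b - a, it does not depend on the mesh. *)
Lemma tilted_growth alpha lambda h K tau M N (e : nat -> nat -> R)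
    (c := K * (lambda `^ alpha * (alpha - 1))) :
  1 < alpha < 2 -> 0 <= lambda -> 0 < h -> 0 <= K -> 0 <= tau -> 4 * c * tau <= 1 ->
  (forall n, (n <= N)%N -> e n 0%N = 0) -> (forall n, (n <= N)%N -> e n M = 0) ->
  (forall i n, (1 <= i < M)%N -> (n < N)%N ->
    compact_op lambda h (e n.+1) i - K * tau * space_op alpha lambda h (e n.+1) i
    = compact_op lambda h (e n) i) ->
  forall n, (n <= N)%N ->
  sqnorm M (e n) <=
    3 * expR (4 * c * (n%:R * tau) + 2 * (lambda * h * M%:R)) * sqnorm M (e 0%N).
Proof.
move=> a12 l0 h0 K0 tau0 ct e0 eM step n nN.
pose v n := tilt lambda h (e n).
have v0 m : (m <= N)%N -> v m 0%N = 0 by move=> mN; rewrite /v /tilt e0// mulr0.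
have vM m : (m <= N)%N -> v m M = 0 by move=> mN; rewrite /v /tilt eM// mulr0.
have c0 : 0 <= c by rewrite /c !mulr_ge0 ?powR_ge0//; lra.
have ct0 : 0 <= c * tau by exact: mulr_ge0.
have growth m : (m <= N)%N -> energy h M (v m) (v m) <=
    expR (4 * c * (m%:R * tau)) * energy h M (v 0%N) (v 0%N).
  elim: m => [|m IHm] mN; first by rewrite mul0r mulr0 expR0 mul1r.
  have mN' : (m <= N)%N by exact: ltnW.
  apply: (@le_trans _ _ ((1 + 4 * c * tau) * energy h M (v m) (v m))).
    have := energy_step alpha lambda h K tau M (e m) (e m.+1) a12 l0 h0 K0 tau0
      (e0 _ mN') (eM _ mN') (e0 _ mN) (eM _ mN) (fun i iM => step i m iM mN).
    rewrite -/c -/(v m) -/(v m.+1) /= => F.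
    have /andP[Em _] := energy_bounds h M (v m.+1) (v0 _ mN) (vM _ mN).
    have sq0 : 0 <= sqnorm M (v m.+1) by apply: sumr_ge0 => i _; exact: sqr_ge0.
    have E0 : 0 <= energy h M (v m.+1) (v m.+1) by move: sq0 Em; clear; lra.
    have ct1 : 0 <= 1 + 4 * c * tau by move: ct0; clear; lra.
    have := ler_wpM2l ct1 F.
    (* (1 + 4 c tau)(1 - 2 c tau) = 1 + 2 c tau (1 - 4 c tau), which is at least 1 for small
       steps. *)
    have : 0 <= (2 * (c * tau) * (1 - 4 * c * tau)) * energy h M (v m.+1) (v m.+1).
      apply: mulr_ge0 => //; apply: mulr_ge0; first by move: ct0; clear; lra.
      by move: ct; clear; lra.
    by clear; lra.
  have -> : 4 * c * (m.+1%:R * tau) = 4 * c * tau + 4 * c * (m%:R * tau).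
    by rewrite -natr1; lra.
  rewrite expRD -[X in _ <= X]mulrA; apply: ler_pM; last exact: IHm.
  - by move: ct0; clear; lra.
  - have /andP[Em _] := energy_bounds h M (v m) (v0 _ mN') (vM _ mN').
    have : 0 <= sqnorm M (v m) by apply: sumr_ge0 => i _; exact: sqr_ge0.
    by move: Em; clear; lra.
  - exact: expR_ge1Dx.
have lh0 : 0 <= lambda * h by rewrite mulr_ge0// ltW.
have lower : sqnorm M (e n) <= sqnorm M (v n).
  apply: ler_sum => i _; rewrite /v /tilt exprMn ler_peMl ?sqr_ge0//.
  by rewrite exprn_ege1// -expR0 ler_expR mulr_ge0.
have upper : sqnorm M (v 0%N) <= expR (2 * (lambda * h * M%:R)) * sqnorm M (e 0%N).
  rewrite mulr_sumr !big_nat; apply: ler_sum => i /andP[_ iM].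
  rewrite /v /tilt exprMn ler_wpM2r ?sqr_ge0// -expRM_natl ler_expR.
  by rewrite ler_wpM2l// ler_wpM2l// ler_nat ltnW.
have /andP[En _] := energy_bounds h M (v n) (v0 _ nN) (vM _ nN).
have /andP[_ E0] := energy_bounds h M (v 0%N) (v0 _ (leq0n N)) (vM _ (leq0n N)).
rewrite expRD; set p := expR (4 * _ * _).
have p0 : 0 <= p by exact: expR_ge0.
have := growth n nN; rewrite -/p.
have := ler_wpM2l p0 (le_trans E0 upper).
by move: lower En; clear; lra.
Qed.

Lemma grid_norm_le M h (C : R) V W : 0 <= h -> 0 <= C -> sqnorm M V <= C * sqnorm M W ->
  grid_norm M h V <= Num.sqrt C * grid_norm M h W.
Proof.
move=> h0 C0 VW; rewrite /grid_norm -sqrtrM// ler_wsqrtr//.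
by rewrite mulrCA ler_wpM2l.
Qed.

End OneStep.

Theorem theorem3p2 (R : realType) (a b T lambda K : R)
    (hab : a < b) (hT : 0 < T) (hlambda : 0 <= lambda) (hK : 0 <= K)
    (alpha : R) (halpha1 : 1 < alpha) (halpha2 : alpha < 2) :
  scheme_stable alpha lambda K a b T
    (fun h : R => 0 < h /\ (0 < lambda -> h <= 1 / lambda)).
Proof.
have a12 : 1 < alpha < 2 by rewrite halpha1.
pose c := K * (lambda `^ alpha * (alpha - 1)).
have c0 : 0 <= c by rewrite /c !mulr_ge0 ?powR_ge0//; lra.
pose m := Num.bound (4 * c * T).
pose C1 := 3 * expR (4 * c * T + 2 * (lambda * (b - a))).
pose C2 : R := 100 ^+ m.
have C10 : 0 <= C1 by rewrite mulr_ge0 ?expR_ge0.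
have C20 : 0 <= C2 by exact: exprn_ge0.
(* The constant is fixed before tau is known: [C1] bounds the squared norms for small steps, [C2]
   for large ones, and their sum serves both. *)
exists (Num.sqrt (C1 + C2)) => M N M0 N0 [h0 hl] f ub u0 u0' U U'.
case=> _ U0 UM Ustep [_ U'0 U'M U'step] n nN.
apply: grid_norm_le; [exact: ltW|exact: addr_ge0|].
set h := mesh a b M in h0 hl Ustep U'step *.
set tau := time_step T N in UM Ustep U'M U'step.
have lh : lambda * h <= 1.
  move: hlambda; rewrite le_eqVlt => /predU1P[<-|l0]; first by rewrite mul0r ler01.
  by have := hl l0; rewrite ler_pdivlMr// mulrC.
have Ntau : N%:R * tau = T by rewrite /tau /time_step mulrC divfK// pnatr_eq0 -lt0n.
have tau0 : 0 < tau by rewrite divr_gt0// ltr0n.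
pose e k i := U' k i - U k i.
have e0 k : (k <= N)%N -> e k 0%N = 0 by move=> kN; rewrite /e U'0// U0// subrr.
have eM k : (k <= N)%N -> e k M = 0 by move=> kN; rewrite /e U'M// UM// subrr.
have step i k : (1 <= i < M)%N -> (k < N)%N ->
    compact_op lambda h (e k.+1) i - K * tau * space_op alpha lambda h (e k.+1) i
    = compact_op lambda h (e k) i.
  move=> iM kN; rewrite compact_opB space_opB compact_opB.
  have iM' : (1 <= i <= M.-1)%N.
    by case/andP: iM => i1 iM; rewrite i1 -[(i <= _)%N]ltnS prednK.
  have kN' : (k <= N.-1)%N by rewrite -ltnS prednK.
  by have := Ustep i k iM' kN'; have := U'step i k iM' kN'; clear; lra.
have sq0 : 0 <= \sum_(1 <= i < M) e 0%N i ^+ 2 by apply: sumr_ge0 => i _; exact: sqr_ge0.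
rewrite -[X in X <= _]/(\sum_(1 <= i < M) e n i ^+ 2).
rewrite -[X in _ <= _ * X]/(\sum_(1 <= i < M) e 0%N i ^+ 2).
have [small|large] := leP (4 * c * tau) 1.
  have := tilted_growth alpha lambda h K tau M N e a12 hlambda h0 hK (ltW tau0) small
    e0 eM step n nN.
  move/le_trans; apply; apply: ler_wpM2r => //.
  apply: (@le_trans _ _ C1); last by rewrite lerDl.
  rewrite /C1; apply: ler_wpM2l => //; rewrite ler_expR; apply: lerD.
    apply: ler_wpM2l; first exact: mulr_ge0.
    by rewrite -Ntau; apply: ler_wpM2r; [exact: ltW|rewrite ler_nat].
  by rewrite /h /mesh -mulrA divfK// pnatr_eq0 -lt0n.
(* A large step forces N < 4 c T, so boundedly many steps are taken. *)
have pow k : (k <= N)%N -> \sum_(1 <= i < M) e k i ^+ 2 <=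
    100 ^+ k * \sum_(1 <= i < M) e 0%N i ^+ 2.
  elim: k => [|k IHk] kN; first by rewrite expr0 mul1r.
  have kN' := ltnW kN.
  apply: le_trans (implicit_step_le alpha lambda h (K * tau) M (e k) (e k.+1) a12
    hlambda h0 lh (mulr_ge0 hK (ltW tau0)) (e0 _ kN') (eM _ kN') (e0 _ kN) (eM _ kN)
    (fun i iM => step i k iM kN)) _.
  by rewrite exprS -mulrA ler_wpM2l// IHk.
apply: (le_trans (pow n nN)); apply: ler_wpM2r => //.
apply: (@le_trans _ _ C2); last by rewrite lerDr.
rewrite /C2; apply: ler_weXn2l; first by rewrite ler1n.
have Nm : (N%:R : R) < m%:R.
  apply: le_lt_trans (archi_boundP _); last first.
    by apply: mulr_ge0; [exact: mulr_ge0|exact: ltW].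
  rewrite -Ntau (mulrCA (4 * c)) ler_peMr ?ler0n//; exact: ltW.
by rewrite (leq_trans nN)// -(ler_nat R) ltW.
Qed.
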